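(* Let $G$ be a Class 1 graph with $\Delta(G)=4$ and let $t\geq 5$ be an integer. Then every proper $t$-edge coloring of $G$ can be transformed to any proper $4$-edge coloring of $G$ by a sequence of interchanges.
   Context: All graphs are finite, without loops and multiple edges. $\Delta(G)$ is the maximum degree of $G$. A proper $t$-edge coloring of $G$ is a map $f:E(G)\to\{1,\dots,t\}$ with $f(e)\neq f(e')$ for adjacent edges $e,e'$. The chromatic index $\chi'(G)$ is the least $k$ for which a proper $k$-edge coloring exists; $G$ is Class 1 if $\chi'(G)=\Delta(G)$ and Class 2 if $\chi'(G)=\Delta(G)+1$. For a proper edge coloring $f$ and colors $a,b$, $G_f(a,b)$ is the subgraph induced by the edges colored $a$ or $b$. An interchange (Kempe change) consists of swapping colors $a$ and $b$ on one connected component of $G_f(a,b)$; this yields another proper edge coloring. A proper $4$-edge coloring is regarded as a proper $t$-edge coloring using only colors from $\{1,2,3,4\}$. *)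

(* Defs.v *)
From HB Require Import structures.
From mathcomp Require Import all_boot.
Set Implicit Arguments. Unset Strict Implicit. Unset Printing Implicit Defensive.

(* A finite simple graph: vertex type T : finType, adjacency e : rel T,
   assumed symmetric and irreflexive (hypotheses of the theorem).
   Edges are the 2-element vertex sets {x, y} with e x y. *)
Section Graph.
Variables (T : finType) (e : rel T).

Definition edge_set : {set {set T}} :=
  [set E | [exists x, exists y, e x y && (E == [set x; y])]].

Definition Edge : predArgType := {E : {set T} | E \in edge_set}.

Definition deg (x : T) : nat := #|[set y | e x y]|.

Definition maxdeg : nat := \max_(x : T) deg x.

Definition adj_edges (E1 E2 : Edge) : bool :=
  (E1 != E2) && (val E1 :&: val E2 != set0).

Definition proper_coloring (t : nat) (f : {ffun Edge -> nat}) : Prop :=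
  (forall E, 1 <= f E <= t) /\
  (forall E1 E2, adj_edges E1 E2 -> f E1 != f E2).

Definition class1 : Prop :=
  (exists f, proper_coloring maxdeg f) /\
  (forall k f, proper_coloring k f -> maxdeg <= k).

Definition kempe_rel (f : {ffun Edge -> nat}) (a b : nat) : rel Edge :=
  fun E1 E2 => [&& f E1 \in [:: a; b], f E2 \in [:: a; b] & adj_edges E1 E2].

Definition swap (a b c : nat) : nat :=
  if c == a then b else if c == b then a else c.

Definition interchange (t : nat) (f g : {ffun Edge -> nat}) : Prop :=
  exists a b (E0 : Edge),
    [/\ 1 <= a <= t, 1 <= b <= t, f E0 \in [:: a; b] &
    forall E, g E = if connect (kempe_rel f a b) E0 E then swap a b (f E)
                    else f E].

Inductive kempe_reach (t : nat) : {ffun Edge -> nat} -> {ffun Edge -> nat} -> Prop :=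
| kr_refl f : kempe_reach t f f
| kr_step f g h : interchange t f g -> kempe_reach t g h -> kempe_reach t f h.

End Graph.

(* Main.v *)
Require Import Defs.
From Stdlib Require Import Classical_Prop.
From mathcomp Require Import all_boot zify.
Set Implicit Arguments.
Unset Strict Implicit.
Unset Printing Implicit Defensive.

(** Vizing fans remove the colours above 5. Then the colour classes of [g] are made
    colour classes of [f] one at a time, always keeping one spare colour: once some
    [z]-class is right, it is deleted from the graph together with the colour [z].
    To obtain the class [M] of [g] (turned into a perfect matching by doubling the
    graph), take a reachable colouring whose [z]-class is closest to [M]. If an edge
    outside [M] still has colour [z], a fan produces a vertex [p] missing [z], with
    [M]-partner [q] and a wrong [z]-edge [qr]. Let [a] be the colour of [pq], let [q]
    miss [c] and [r] miss [b]. If [h] and [s] are the ends of the [a]-edge of [r] and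
    of the [z]-edge of [h], minimality forces [h] to miss the fourth ordinary colour
    [d], and exchanging [z] and [a] on the path [p q r h s] shows that [s] cannot miss
    [a]. Kempe changes that avoid [p q r h] would make [s] miss [a] unless [pr] has
    colour [c] and the [d]-neighbour of [r] misses [z]; then [h] must be the
    [b]-neighbour of [q], and by the symmetry of the triangle [p q r] also that of
    [p], which is absurd. *)

(** * Kempe switches *)

Lemma swapL a b : swap a b a = b.
Proof. by rewrite /swap eqxx. Qed.

Lemma swapR a b : swap a b b = a.
Proof. by rewrite /swap eqxx; case: eqP. Qed.

Lemma swap_id a b c : c != a -> c != b -> swap a b c = c.
Proof. by rewrite /swap => /negPf-> /negPf->. Qed.

Lemma swapK a b : involutive (swap a b).
Proof. by move=> c; rewrite /swap; do !case: eqP => //; congruence. Qed.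

Lemma eq_swap a b c d : (swap a b c == d) = (c == swap a b d).
Proof. by apply/eqP/eqP => [<-|->]; rewrite swapK. Qed.

(** Where degrees are at most two, a simple path between two vertices of degree at most one is a
    whole component. A third vertex in it is interior, so it has two distinct neighbours. *)
Lemma path_ends (T : finType) (R : rel T) (x y w : T) :
  (forall v a b c, R v a -> R v b -> R v c -> a != b -> c = a \/ c = b) ->
  symmetric R ->
  (forall a b, R x a -> R x b -> a = b) ->
  (forall a b, R y a -> R y b -> a = b) ->
  (forall a b, R w a -> R w b -> a = b) ->
  connect R x y -> connect R x w -> x != y -> w != x -> w != y -> False.
Proof.
move=> deg2 Rsym xend yend wend /connectP[p0 pth0 ey] xw nxy nwx nwy.
move: ey; case/shortenP: pth0 => p pth Up _ ey {p0}.
have nbr v : v \in p -> exists u, [/\ R v u, u \in x :: p &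
    v = y \/ exists u', [/\ R v u', u' \in x :: p & u != u']].
  move=> vp; case/splitPr: vp pth Up ey => p1 p2 pth Up ey.
  move: pth; rewrite cat_path /= => /and3P[_ Rv pth2].
  exists (last x p1); split; first by rewrite Rsym.
    by rewrite -cat_cons mem_cat mem_last.
  case: p2 => [|n p2] in Up ey pth2 *; first by left; rewrite ey last_cat.
  right; exists n; split.
  - by case/andP: pth2.
  - by rewrite inE mem_cat !inE eqxx !orbT.
  move: Up; rewrite -cat_cons cat_uniq => /and3P[_ /hasPn/(_ n)+ _].
  rewrite !inE eqxx !orbT => /(_ isT) Hn; apply: contraNneq Hn => <-.
  exact: mem_last.
have clos v u : v \in x :: p -> R v u -> u \in x :: p.
  rewrite inE => /predU1P[->|vp] Rvu.
    case: p => [|x1 p] in pth ey Up nbr *; first by rewrite ey /= eqxx in nxy.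
    by case/andP: pth => Rx _; rewrite (xend _ _ Rvu Rx) !inE eqxx orbT.
  have [u1 [R1 m1 [vy|[u2 [R2 m2 n12]]]]] := nbr v vp.
    by rewrite vy in Rvu R1; rewrite (yend _ _ Rvu R1).
  by case: (deg2 _ _ _ _ R1 R2 Rvu n12) => ->.
have wp : w \in x :: p.
  have walk q v : v \in x :: p -> path R v q -> last v q \in x :: p.
    elim: q v => [|n q IH] v //= vp /andP[Rvn].
    exact: IH (clos _ _ vp Rvn).
  by case/connectP: xw => q pq ->; apply: walk pq; rewrite mem_head.
move: wp; rewrite inE (negPf nwx) /= => wp.
have [u1 [R1 _ [/eqP|[u2 [R2 _ n12]]]]] := nbr w wp; first by rewrite (negPf nwy).
by rewrite (wend _ _ R1 R2) eqxx in n12.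
Qed.

Section Colorings.
Variable T : finType.
Implicit Types (f g : T -> T -> nat) (K : {set T}) (C : seq nat).

(* A colouring is a symmetric matrix of colours in which 0 marks a non-edge. *)
Record valid C f : Prop := Valid {
  vsym : forall x y, f x y = f y x;
  virr : forall x, f x x = 0;
  vcol : forall x y, f x y != 0 -> f x y \in C;
  vinj : forall x y y', f x y = f x y' -> f x y != 0 -> y = y' }.

Definition nbrs f x := [set y | f x y != 0].

Definition miss f x a := [forall y, f x y != a].

(* [K] is a union of components of the a/b-graph, possibly containing isolated vertices,
   so that a flip may amount to any number of interchanges, even none. In this form
   flips restrict to subgraphs. *)
Definition kclosed f a b K :=
  forall x y, x \in K -> f x y \in [:: a; b] -> y \in K.

Definition flip f a b K x y := if x \in K then swap a b (f x y) else f x y.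

Inductive reach C : (T -> T -> nat) -> (T -> T -> nat) -> Prop :=
| reach_eq f g : f =2 g -> reach C f g
| reach_flip f g a b K : a \in C -> b \in C -> kclosed f a b K ->
    reach C (flip f a b K) g -> reach C f g.

Definition kcomp f a b x :=
  [set y | connect [rel u v | f u v \in [:: a; b]] x y].

Lemma missP f x a : reflect (forall y, f x y <> a) (miss f x a).
Proof. by apply: (iffP forallP) => H y; apply/eqP/H. Qed.

Lemma miss_neq f x a y : miss f x a -> f x y != a.
Proof. by move/forallP. Qed.

Lemma missPn f x a : ~~ miss f x a -> exists y, f x y = a.
Proof. by rewrite negb_forall => /existsP[y]; rewrite negbK => /eqP; exists y. Qed.

Lemma reach_refl C f : reach C f f.
Proof. exact: reach_eq. Qed.

Lemma reach_eql C f f' g : f =2 f' -> reach C f' g -> reach C f g.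
Proof.
move=> ff r; elim: r f ff => {f' g} [f' g fg f ff|f' g a b K aC bC cl _ IH f ff].
  by apply: reach_eq => x y; rewrite ff fg.
apply: (@reach_flip _ _ _ a b K) => //; first by move=> x y; rewrite ff; apply: cl.
by apply: IH => x y; rewrite /flip ff.
Qed.

Lemma reach_trans C f g h : reach C f g -> reach C g h -> reach C f h.
Proof.
elim=> {f g} [f g fg|f g a b K aC bC cl _ IH gh]; first exact: reach_eql.
exact: reach_flip aC bC cl (IH gh).
Qed.

Lemma reach_sub C C' f g : {subset C <= C'} -> reach C f g -> reach C' f g.
Proof.
move=> s; elim=> {f g} [f g|f g a b K aC bC cl _ IH]; first exact: reach_eq.
exact: reach_flip (s _ aC) (s _ bC) cl IH.
Qed.

Lemma reach_flip1 C f a b K : a \in C -> b \in C -> kclosed f a b K ->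
  reach C f (flip f a b K).
Proof. by move=> aC bC cl; apply: reach_flip aC bC cl _; apply: reach_refl. Qed.

Lemma flip_out f a b K x y : x \notin K -> flip f a b K x y = f x y.
Proof. by rewrite /flip => /negPf->. Qed.

Lemma flip_in f a b K x y : x \in K -> flip f a b K x y = swap a b (f x y).
Proof. by rewrite /flip => ->. Qed.

Lemma flip_other f a b K x y c : c != a -> c != b ->
  (flip f a b K x y == c) = (f x y == c).
Proof. by move=> ca cb; rewrite /flip; case: ifP => // _; rewrite eq_swap swap_id. Qed.

Lemma flip_keep f a b K x y c : c != a -> c != b -> f x y = c ->
  flip f a b K x y = c.
Proof. by move=> ca cb fc; apply/eqP; rewrite flip_other // fc. Qed.

Lemma miss_other f a b K x c : c != a -> c != b ->
  miss (flip f a b K) x c = miss f x c.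
Proof. by move=> ca cb; apply: eq_forallb => y; rewrite flip_other. Qed.

Lemma miss_out f a b K x c : x \notin K -> miss (flip f a b K) x c = miss f x c.
Proof. by move=> xK; apply: eq_forallb => y; rewrite flip_out. Qed.

Lemma miss_in f a b K x c : x \in K ->
  miss (flip f a b K) x c = miss f x (swap a b c).
Proof. by move=> xK; apply: eq_forallb => y; rewrite flip_in // eq_swap. Qed.

(** Closedness of [K] puts both ends of an [a]- or [b]-edge on the same side of [K], which keeps the
    matrix symmetric. As [0] is not a colour, non-edges stay non-edges. *)
Lemma valid_flip C f a b K : valid C f -> 0 \notin C -> a \in C -> b \in C ->
  kclosed f a b K -> valid C (flip f a b K).
Proof.
move=> vf C0 aC bC cl.
have s0 : swap a b 0 = 0.
  by apply: swap_id; apply: contraNneq C0 => ->.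
split=> [x y|x|x y|x y y'].
- have half u v : u \in K -> flip f a b K u v = flip f a b K v u.
    move=> uK; rewrite flip_in //; have [vK|vK] := boolP (v \in K).
      by rewrite flip_in // (vsym vf).
    rewrite flip_out // (vsym vf) swap_id //; apply: contraNneq vK => e;
    by apply: cl uK _; rewrite (vsym vf) e !inE eqxx ?orbT.
  have [xK|xK] := boolP (x \in K); first exact: half.
  have [yK|yK] := boolP (y \in K); first by rewrite -half.
  by rewrite !flip_out // (vsym vf).
- by rewrite /flip (virr vf) s0; case: ifP.
- have [xK|xK] := boolP (x \in K); last by rewrite flip_out //; apply: vcol vf _ _.
  rewrite flip_in // eq_swap s0 => /(vcol vf).
  by rewrite /swap; do 2?case: ifP.
- have [xK|xK] := boolP (x \in K); last by rewrite !flip_out //; apply: vinj vf _ _ _.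
  rewrite !flip_in // => /(can_inj (swapK a b)); rewrite eq_swap s0.
  exact: vinj vf _ _ _.
Qed.

Lemma flip0 C f a b K x y : 0 \notin C -> a \in C -> b \in C ->
  (flip f a b K x y == 0) = (f x y == 0).
Proof. by move=> C0 aC bC; rewrite flip_other //; apply: contraNneq C0 => ->. Qed.

Lemma nbrs_flip C f a b K x : 0 \notin C -> a \in C -> b \in C ->
  nbrs (flip f a b K) x = nbrs f x.
Proof. by move=> C0 aC bC; apply/setP=> y; rewrite !inE (flip0 _ _ _ _ C0). Qed.

Lemma reach_valid C f g : 0 \notin C -> reach C f g -> valid C f -> valid C g.
Proof.
move=> C0; elim=> {f g} [f g fg [s i c j]|f g a b K aC bC cl _ IH vf].
  split=> [x y|x|x y|x y y']; rewrite -!fg; [exact: s|exact: i|exact: c|exact: j].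
by apply: IH; apply: valid_flip.
Qed.

Lemma reach_0 C f g : 0 \notin C -> reach C f g ->
  forall x y, (g x y == 0) = (f x y == 0).
Proof.
move=> C0; elim=> {f g} [f g fg x y|f g a b K aC bC cl _ IH x y]; first by rewrite fg.
by rewrite IH (flip0 _ _ _ _ C0).
Qed.

Lemma kclosedC f a b K : kclosed f a b K -> kclosed f b a K.
Proof. by move=> cl x y xK; rewrite !inE orbC => e; apply: cl xK _; rewrite !inE. Qed.

Lemma kcomp_refl f a b x : x \in kcomp f a b x.
Proof. by rewrite inE. Qed.

Lemma kcomp_closed f a b x : kclosed f a b (kcomp f a b x).
Proof.
move=> u v; rewrite !inE => xu uv; apply: connect_trans xu _.
by apply: connect1; rewrite /= !inE.
Qed.

Lemma kcomp_sub f a b x y K : kclosed f a b K -> x \in K -> y \in kcomp f a b x ->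
  y \in K.
Proof.
move=> cl xK; rewrite inE => /connectP[p pth ->]; elim: p x xK pth => //= u p IH x xK.
by case/andP=> xu; apply: IH; apply: cl xK xu.
Qed.

Lemma valid_sub C C' f : {subset C <= C'} -> valid C f -> valid C' f.
Proof. by move=> s [fs fi fc fj]; split=> // x y /fc/s. Qed.

Lemma card_nbrs_le C f (D : seq nat) x : valid C f ->
  (forall y, f x y != 0 -> f x y \in D) -> #|nbrs f x| <= size D.
Proof.
move=> vf sub; rewrite cardE -(size_map (f x)); apply: uniq_leq_size.
  rewrite map_inj_in_uniq ?enum_uniq // => y y'; rewrite !mem_enum !inE => fy _ e.
  exact: vinj vf _ _ _ e fy.
by move=> _ /mapP[y +->]; rewrite mem_enum inE; apply: sub.
Qed.

Lemma exists_missing f (D : seq nat) x : uniq D -> 0 \notin D ->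
  #|nbrs f x| < size D -> exists2 a, a \in D & miss f x a.
Proof.
move=> U D0 lt; apply/hasP; rewrite -[has _ _]negbK -all_predC; apply/negP => /allP full.
have sub : {subset D <= [seq f x y | y <- enum (nbrs f x)]}.
  move=> a aD; have /missPn[y fxy] := full a aD.
  apply/mapP; exists y => //; rewrite mem_enum inE fxy.
  by apply: contraNneq D0 => <-.
by have := uniq_leq_size U sub; rewrite size_map -cardE leqNgt lt.
Qed.

Section Valid.
Variables (C : seq nat) (f : T -> T -> nat).
Hypotheses (vf : valid C f).

Lemma kcomp_sym a b (x y : T) : (y \in kcomp f a b x) = (x \in kcomp f a b y).
Proof.
rewrite !inE; apply: sym_connect_sym => u v /=; by rewrite (vsym vf).
Qed.

Lemma kcomp_edge a b (x u v : T) : f u v \in [:: a; b] -> u \in kcomp f a b x ->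
  v \in kcomp f a b x.
Proof. by move=> fuv ux; apply: kcomp_closed ux fuv. Qed.

Lemma kcomp_trans a b (x y w : T) : y \in kcomp f a b x -> w \in kcomp f a b y ->
  w \in kcomp f a b x.
Proof. by rewrite !inE; apply: connect_trans. Qed.

Lemma kcomp_notin a b (x y w : T) : y \in kcomp f a b x -> w \notin kcomp f a b x ->
  y \notin kcomp f a b w.
Proof. by move=> xy; apply: contra; rewrite kcomp_sym; apply: kcomp_trans. Qed.

Lemma kcomp_nedge a b (x u v : T) : f u v \in [:: a; b] -> u \notin kcomp f a b x ->
  v \notin kcomp f a b x.
Proof. by move=> uv; apply: contra; apply: kcomp_edge; rewrite (vsym vf). Qed.

(** In the a/b-graph degrees are at most two, and a vertex missing [a] or [b] has degree at most
    one. This is the main source of components that avoid given vertices. *)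
Lemma three_ends a b (x y w : T) : a != 0 -> b != 0 ->
  miss f x a || miss f x b -> miss f y a || miss f y b -> miss f w a || miss f w b ->
  y \in kcomp f a b x -> x != y -> w != x -> w != y -> w \notin kcomp f a b x.
Proof.
move=> a0 b0 ex ey ew xy nxy nwx nwy; apply/negP; move: xy; rewrite !inE => xy xw.
have ends v : miss f v a || miss f v b -> forall u u',
    [rel u v | f u v \in [:: a; b]] v u -> [rel u v | f u v \in [:: a; b]] v u' -> u = u'.
  move=> ev u u' /=; rewrite !inE => h h'.
  case/orP: ev => /missP m; case/orP: h => /eqP h; case/orP: h' => /eqP h';
    by [case: (m _ h)|case: (m _ h')|apply: (vinj vf (x := v)); rewrite ?h ?h'].
apply: (path_ends (R := [rel u v | f u v \in [:: a; b]]) _ _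
  (ends _ ex) (ends _ ey) (ends _ ew) xy xw) => //.
- move=> v u1 u2 u3 /=; rewrite !inE => h1 h2 h3 n12.
  have key u u' : f v u = f v u' -> f v u = a \/ f v u = b -> u = u'.
    by move=> e [h|h]; apply: (vinj vf (x := v) e); rewrite h.
  case/orP: h1 => /eqP h1; case/orP: h2 => /eqP h2; case/orP: h3 => /eqP h3;
    try (by left; apply: key; [rewrite h1 h3|rewrite h3; auto]);
    try (by right; apply: key; [rewrite h2 h3|rewrite h3; auto]).
  + by case/eqP: n12; apply: key; [rewrite h1 h2|auto].
  + by case/eqP: n12; apply: key; [rewrite h1 h2|auto].
- by move=> u v /=; rewrite (vsym vf).
Qed.

End Valid.
End Colorings.

(** The preimage of a closed set is closed, even if a component falls apart under restriction. *)
Lemma reach_embed (T U : finType) (i : U -> T) C (f g : T -> T -> nat) : reach C f g ->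
  reach C (fun u v => f (i u) (i v)) (fun u v => g (i u) (i v)).
Proof.
elim=> {f g} [f g fg|f g a b K aC bC cl _ IH].
  by apply: reach_eq => u v; apply: fg.
apply: (@reach_flip _ _ _ _ a b [set u | i u \in K]) => //.
  by move=> u v; rewrite inE => uK /(cl _ _ uK); rewrite inE.
by apply: reach_eql IH => u v; rewrite /flip inE.
Qed.

(** * Vizing fans *)

Section Palette.
Variables (T : finType) (z : nat) (O : seq nat).
Hypotheses (z0 : z != 0) (O0 : 0 \notin O) (zO : z \notin O).
Implicit Types (f g : T -> T -> nat) (K : {set T}) (x y u v : T).

Let C := z :: O.

Lemma palette0 : 0 \notin C.
Proof. by rewrite inE negb_or eq_sym z0. Qed.

Lemma palette_ord a : a \in O -> a \in C.
Proof. by rewrite inE => ->; rewrite orbT. Qed.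

Lemma ord_neq0 a : a \in O -> a != 0.
Proof. by apply: contraTneq => ->. Qed.

Lemma ord_neqz a : a \in O -> a != z.
Proof. by apply: contraTneq => ->. Qed.

Hint Resolve palette0 palette_ord ord_neq0 ord_neqz : core.

Definition same_z f g := forall x y, (g x y == z) = (f x y == z).

Definition drop_edge f g u v := forall x y,
  (g x y == z) = (f x y == z) && ~~ ((x == u) && (y == v) || (x == v) && (y == u)).

Lemma same_z_flip f a b K : a \in O -> b \in O -> same_z f (flip f a b K).
Proof. by move=> aO bO x y; rewrite flip_other // eq_sym ord_neqz. Qed.

Lemma drop_edge_same f f' g u v : same_z f f' -> drop_edge f' g u v -> drop_edge f g u v.
Proof. by move=> s d x y; rewrite d s. Qed.

(** The edge [uv] is a whole a/b-component. Besides allowing its recolouring, this refutes links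
    from its ends to other vertices. *)
Lemma kclosed2 f a b u v : valid C f -> a \in C -> f u v = a ->
  miss f u b -> miss f v b -> kclosed f a b [set u; v].
Proof.
move=> vf aC fuv mu mv x y; have a0 : a != 0 by apply: contraNneq palette0 => <-.
rewrite !inE => /orP[] /eqP-> /orP[] /eqP e;
  try by [case: (missP _ _ _ mu _ e)|case: (missP _ _ _ mv _ e)].
- by rewrite (vinj vf (x := u) (y := y) (y' := v)) ?eqxx ?orbT // e.
- by rewrite (vinj vf (x := v) (y := y) (y' := u)) ?eqxx // e // (vsym vf).
Qed.

(** A Vizing fan with centre [u]; only [w 0] to [w k] matter. Its edges after the first have
    ordinary colours, so that rotating it removes [uv] from the z-class and changes nothing else
    there. *)
Record fan f u v (w : nat -> T) k : Prop := Fan {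
  fan0 : w 0 = v;
  fan_inj : forall i j, i <= k -> j <= k -> w i = w j -> i = j;
  fan_ord : forall i, i < k -> f u (w i.+1) \in O;
  fan_miss : forall i, i < k -> miss f (w i) (f u (w i.+1)) }.

Lemma fan_sub f u v w k l : l <= k -> fan f u v w k -> fan f u v w l.
Proof.
move=> lk [w0 wi wo wm]; split=> // [i j il jl|i il|i il].
- by apply: wi; apply: leq_trans lk.
- by apply: wo; apply: leq_trans lk.
- by apply: wm; apply: leq_trans lk.
Qed.

Lemma fan_nbr f u v w k i : f u v = z -> fan f u v w k -> i <= k -> f u (w i) \in C.
Proof.
move=> fuv [w0 _ wo _]; case: i => [_|i ik]; first by rewrite w0 fuv mem_head.
by rewrite palette_ord ?wo.
Qed.

Lemma fan_neq f u v w k i : valid C f -> f u v = z -> fan f u v w k -> i <= k -> w i != u.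
Proof.
move=> vf fuv F ik; apply: contraNneq palette0 => wu.
by have := fan_nbr fuv F ik; rewrite wu (virr vf).
Qed.

Lemma fan_flip f u v w k a b K : fan f u v w k ->
  (forall i, i <= k -> flip f a b K u (w i) = f u (w i)) ->
  (forall i, i < k -> miss (flip f a b K) (w i) (f u (w i.+1))) ->
  fan (flip f a b K) u v w k.
Proof. by move=> [w0 wi wo wm] h m; split=> // i ik; rewrite h // ?wo ?m. Qed.

(** The last edge takes [b], which frees its old colour at [u] for the edge before it, and so on
    down to [uv], which gives up [z]. Each recolouring switches a one-edge component. *)
Lemma fan_shift k f u v w b : valid C f -> f u v = z -> fan f u v w k ->
  b \in O -> miss f u b -> miss f (w k) b ->
  exists2 g, reach C f g & drop_edge f g u v.
Proof.
elim: k f b => [|k IH] f b vf fuv F bO mu mw.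
  have wv := fan0 F; rewrite wv in mw.
  exists (flip f z b [set u; v]).
    apply: reach_flip1; rewrite ?mem_head //; first exact: palette_ord.
    by apply: kclosed2; rewrite ?mem_head.
  move=> x y; have [xK|] := boolP (x \in [set u; v]); last first.
    by rewrite !inE negb_or => /andP[/negPf xu /negPf xv]; rewrite flip_out ?inE xu xv //= andbT.
  rewrite flip_in // eq_swap swapL; transitivity false.
    by case/set2P: xK => ->; apply/eqP; apply/missP.
  symmetry; apply/negP => /andP[/eqP fxy]; apply/negP; rewrite negbK.
  case/set2P: xK fxy => -> fxy; rewrite eqxx /=; apply/orP.
    by left; apply/eqP/(vinj vf (x := u)); rewrite fxy.
  by right; apply/eqP/(vinj vf (x := v)); rewrite fxy // (vsym vf).
set c := f u (w k.+1); have cO : c \in O by apply: (fan_ord F).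
have cl : kclosed f c b [set u; w k.+1] by apply: kclosed2; auto.
have cb : c != b by apply: miss_neq.
have out i : i <= k -> w i \notin [set u; w k.+1].
  move=> ik; rewrite !inE negb_or (fan_neq vf fuv F) ?(leqW ik) //=.
  by apply/eqP => /(fan_inj F); rewrite leqW // leqnn => /(_ isT isT); lia.
have F' : fan (flip f c b [set u; w k.+1]) u v w k.
  apply: fan_flip (fan_sub (leqnSn k) F) _ _ => i ik.
    apply: flip_keep => //; last exact: miss_neq.
    apply/eqP => e.
    suff /(fan_inj F (leqW ik) (leqnn k.+1)) : w i = w k.+1 by lia.
    by apply: (vinj vf e); rewrite e ord_neq0.
  by rewrite miss_out ?out ?(fan_miss F) // ltnW.
have [] := IH _ c (valid_flip vf palette0 (palette_ord cO) (palette_ord bO) cl) _ F' cO.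
- by apply: flip_keep => //; rewrite eq_sym ord_neqz.
- by rewrite miss_in ?swapL // !inE eqxx.
- by rewrite miss_out ?out //; apply: (fan_miss F).
move=> g rg dg; exists g; last exact: drop_edge_same (same_z_flip _ _ cO bO) dg.
by apply: reach_flip cl rg; apply: palette_ord.
Qed.

(** The fan grows until its last vertex misses a colour [b] that [u] misses too or that an earlier
    fan edge has. In the second case [u] and two fan vertices are ends of a/b-paths, so one of the
    two can be made to miss [a] without touching [u]. *)
Lemma vizing_fan f u v a : valid C f -> f u v = z -> a \in O -> miss f u a ->
  (forall y, f u y != 0 -> exists2 b, b \in O & miss f y b) ->
  exists2 g, reach C f g & drop_edge f g u v.
Proof.
move=> vf fuv aO mu all_miss.
suff grow n w k : #|T| - k <= n -> fan f u v w k ->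
    exists2 g, reach C f g & drop_edge f g u v.
  by apply: (grow #|T| (fun=> v) 0); rewrite ?leq_subr //; split=> // [[|i] [|j]].
elim: n k w => [|n IH] k w len F.
  (* With no room left, the [k.+1] distinct fan vertices would outnumber [T]. *)
  have inj : injective (fun i : 'I_k.+1 => w i).
    by move=> i j /(fan_inj F) => e; apply/val_inj/e; rewrite -ltnS.
  by have := leq_card _ inj; rewrite card_ord; lia.
have wk0 : f u (w k) != 0.
  by apply: contraNneq palette0 => e; have := fan_nbr fuv F (leqnn k); rewrite e.
have [b bO mw] := all_miss _ wk0.
have [mub|/missPn[x fux]] := boolP (miss f u b); first exact: fan_shift vf fuv F bO mub mw.
have xz : x != v by apply: contraNneq zO => xv; rewrite -fuv -xv fux.
have [/existsP[i /eqP wi]|xnew] := boolP [exists i : 'I_k.+1, w i == x]; last first.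
  pose w' i := if i <= k then w i else x.
  apply: (IH k.+1 w'); first by lia.
  have xn i : i <= k -> w i <> x.
    by move=> ik e; case/existsP: xnew; exists (Ordinal (n := k.+1) (m := i) ik); apply/eqP.
  split=> [|i j|i|i].
  - exact: (fan0 F).
  - rewrite /w' => i1 j1; case: (leqP i k) => ik; case: (leqP j k) => jk.
    + exact: (fan_inj F).
    + by move/(xn _ ik).
    + by move/esym/(xn _ jk).
    + by move=> _; lia.
  - rewrite ltnS leq_eqVlt => /predU1P[->|ik]; rewrite /w' ?ltnn ?fux //.
    by rewrite ik (fan_ord F).
  - rewrite ltnS leq_eqVlt => /predU1P[->|ik]; rewrite /w' ?ltnn ?leqnn ?fux //.
    by rewrite ik (ltnW ik) (fan_miss F).
case: i wi => -[|i] ik /= wi; first by rewrite -wi (fan0 F) eqxx in xz.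
rewrite ltnS in ik.
have ab : a != b by rewrite eq_sym -fux; apply: miss_neq.
have mi : miss f (w i) b by rewrite -fux -wi; apply: (fan_miss F).
have uw j : j <= k -> u != w j by move=> jk; rewrite eq_sym (fan_neq vf fuv F).
have base K l : u \notin K -> l <= k -> kclosed f a b K -> miss (flip f a b K) (w l) a ->
    (forall j, j < l -> miss (flip f a b K) (w j) (f u (w j.+1))) ->
    exists2 g, reach C f g & drop_edge f g u v.
  move=> uK lk cl ml mm.
  have [||||||g rg dg] := @fan_shift l (flip f a b K) u v w a.
  - by apply: valid_flip; auto.
  - by rewrite flip_out.
  - by apply: fan_flip (fan_sub lk F) _ mm => j _; rewrite flip_out.
  - by [].
  - by rewrite miss_out.
  - by [].
  exists g; last exact: drop_edge_same (same_z_flip _ _ aO bO) dg.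
  by apply: reach_flip cl rg; apply: palette_ord.
have na j : j < k -> a != f u (w j.+1).
  by move=> jk; rewrite eq_sym; apply: miss_neq.
have nb j : j < k -> j != i -> f u (w j.+1) != b.
  move=> jk ji; apply: contraNneq ji => e; apply/eqP.
  suff /(fan_inj F jk ik) [] : w j.+1 = w i.+1 by [].
  by rewrite wi; apply: (vinj vf (x := u)); rewrite ?fux // e ord_neq0.
(* Both [w i] and [w k] miss [b], the colour of the fan edge after [w i]. If [w i] is not linked to
   [u], the switch is made at [w i] and the fan is rotated only up to there. *)
have [iu|iu] := boolP (w i \in kcomp f a b u); last first.
  apply: (base (kcomp f a b (w i)) i).
  - by rewrite (kcomp_sym vf).
  - exact: ltnW.
  - exact: kcomp_closed.
  - by rewrite miss_in ?swapL ?kcomp_refl.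
  - move=> j ji; have jk := ltn_trans ji ik.
    by rewrite miss_other ?(fan_miss F) ?nb 1?eq_sym ?na //; lia.
(* Otherwise the a/b-path of [u] ends at [w i], so a switch at [w k] leaves both alone and the whole
   fan can be rotated. *)
have ku : w k \notin kcomp f a b u.
  apply: (three_ends vf (y := w i)); rewrite ?mu ?mi ?mw ?orbT ?ord_neq0 ?uw // 1?ltnW //.
    by rewrite eq_sym uw.
  by apply/eqP => /(fan_inj F (leqnn k) (ltnW ik)); lia.
have ki : w i \notin kcomp f a b (w k).
  rewrite (kcomp_sym vf) //; apply: contra ku; rewrite !inE => h.
  by move: iu; rewrite inE => iu; apply: connect_trans iu h.
apply: (base (kcomp f a b (w k)) k) => //.
- by rewrite (kcomp_sym vf).
- exact: kcomp_closed.
- by rewrite miss_in ?swapL ?kcomp_refl.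
move=> j jk; have [->|ji] := eqVneq j i.
  by rewrite miss_out // wi fux.
by rewrite miss_other ?(fan_miss F) ?nb // eq_sym na.
Qed.

(** * Colourings closest to a matching *)

Section Matching.
Variable mt : T -> T.
Hypotheses (uniqO : uniq O) (sizeO : size O <= 4).
Hypotheses (mtK : involutive mt) (mt_neq : forall x, mt x != x).
Implicit Types p q r h w : T.

Let zC : z \in C. Proof. exact: mem_head. Qed.
Hint Resolve zC : core.

(** For a valid colouring this is the degree of [x] in the symmetric difference of the z-class and
    the matching [mt], so [mu] is twice the size of that difference. *)
Definition wt f x :=
  if f x (mt x) == z then 0 else if miss f x z then 1 else 2.

Definition mu f := \sum_x wt f x.

(** The palette has one colour more than [O], so the degree bound leaves every vertex a missing
    colour. *)
Record stuck f : Prop := Stuck {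
  st_valid : valid C f;
  st_deg : forall x, #|nbrs f x| <= size O;
  st_mt : forall x, f x (mt x) != 0;
  st_min : forall g, reach C f g -> mu f <= mu g }.

Lemma wt_good f x : f x (mt x) = z -> wt f x = 0.
Proof. by rewrite /wt => ->; rewrite eqxx. Qed.

Lemma wt_free f x : miss f x z -> wt f x = 1.
Proof. by move=> m; rewrite /wt m (negPf (miss_neq _ m)). Qed.

Lemma wt_bad f x y : valid C f -> f x y = z -> y != mt x -> wt f x = 2.
Proof.
move=> vf fxy ymt; rewrite /wt; case: eqP => [e|_].
  by case/eqP: ymt; apply: (vinj vf (x := x)); rewrite ?e ?fxy.
by rewrite ifN //; apply/negP => /missP/(_ y).
Qed.

Lemma wt_le2 f x : wt f x <= 2.
Proof. by rewrite /wt; case: ifP => // _; case: ifP. Qed.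

Lemma eq_wt f g x : (forall y, (g x y == z) = (f x y == z)) -> wt g x = wt f x.
Proof.
move=> e; have em : miss g x z = miss f x z by apply: eq_forallb => y; rewrite e.
by rewrite /wt e em.
Qed.

Lemma mu_split f (s : seq T) : uniq s ->
  mu f = \sum_(x <- s) wt f x + \sum_(x | x \notin s) wt f x.
Proof. by move=> Us; rewrite /mu (bigID (mem s)) /= big_uniq. Qed.

Lemma mu_local f g (s : seq T) : uniq s -> (forall x, x \notin s -> wt g x = wt f x) ->
  (mu g <= mu f) = (\sum_(x <- s) wt g x <= \sum_(x <- s) wt f x).
Proof.
by move=> Us e; rewrite !(mu_split _ Us) (eq_bigr (wt f) e) leq_add2r.
Qed.

Lemma stuck_flip f a b K : stuck f -> a \in C -> b \in C -> kclosed f a b K ->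
  mu (flip f a b K) <= mu f -> stuck (flip f a b K).
Proof.
move=> [vf df mf minf] aC bC cl le; split=> [|x|x|g rg].
- exact: valid_flip.
- by rewrite (nbrs_flip f K x palette0 aC bC).
- by rewrite (flip0 f K _ _ palette0 aC bC).
- by apply: leq_trans le _; apply: minf; apply: reach_flip cl rg.
Qed.

Lemma stuck_ord f a b K : stuck f -> a \in O -> b \in O -> kclosed f a b K ->
  stuck (flip f a b K).
Proof.
move=> sf aO bO cl; apply: stuck_flip; auto.
rewrite /mu (eq_bigr (wt f)) // => x _; apply: eq_wt => y.
exact: (same_z_flip f K aO bO).
Qed.

Lemma mu_flip f b (s : seq T) : uniq s ->
  (mu (flip f z b [set x in s]) <= mu f) =
  (\sum_(x <- s) wt (flip f z b [set x in s]) x <= \sum_(x <- s) wt f x).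
Proof.
move=> Us; apply: mu_local => // x xs; apply: eq_wt => y.
by rewrite flip_out // inE.
Qed.

(** Minimality in local form: the switch changes weights in [s] only, so a few explicit weights
    suffice for a contradiction. *)
Lemma stuck_sum f b (s : seq T) : stuck f -> b \in C -> uniq s ->
  kclosed f z b [set x in s] ->
  \sum_(x <- s) wt f x <= \sum_(x <- s) wt (flip f z b [set x in s]) x.
Proof.
move=> sf bC Us cl; rewrite -mu_local //.
  by apply: (st_min sf); apply: reach_flip1.
by move=> x xs; apply/esym/eq_wt => y; rewrite flip_out // inE.
Qed.

(** A vertex-by-vertex form of closedness; [kclosed_seq] makes it a finite check on an explicit
    list. *)
Definition inside f (s : seq T) a x := [forall y, (f x y == a) ==> (y \in s)].

Lemma inside_miss f s a x : miss f x a -> inside f s a x.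
Proof. by move=> m; apply/forallP => y; rewrite (negPf (miss_neq _ m)). Qed.

Lemma inside_edge f s a x y : valid C f -> a \in C -> f x y = a -> y \in s ->
  inside f s a x.
Proof.
move=> vf aC e ys; apply/forallP => y'; apply/implyP => /eqP e'.
rewrite (vinj vf (x := x) (y := y') (y' := y)) ?e ?e' //.
by apply: contraNneq palette0 => <-.
Qed.

Lemma kclosed_seq f a b s : all (fun x => inside f s a x && inside f s b x) s ->
  kclosed f a b [set x in s].
Proof.
move=> /allP H x y; rewrite !inE => /H/andP[/forallP/(_ y) Ha /forallP/(_ y) Hb].
by case/orP=> e; [move: Ha|move: Hb]; rewrite e.
Qed.

Lemma stuck_ordinary f x : stuck f -> ~~ miss f x z -> exists2 b, b \in O & miss f x b.
Proof.
move=> sf xz; have [|||a] := @exists_missing _ f C x; rewrite ?/= ?zO ?ltnS //.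
  exact: st_deg.
rewrite inE => /predU1P[->|aO ma]; last by exists a.
by rewrite (negPf xz).
Qed.

Lemma mt_inj x y : mt x = mt y -> x = y.
Proof. by move=> e; rewrite -(mtK x) e mtK. Qed.

Lemma z_neq f x y : valid C f -> f x y = z -> x != y.
Proof. by move=> vf; apply: contra_eqN => /eqP->; rewrite (virr vf) eq_sym. Qed.

(** Both ends of the wrong z-edge [uv] would go from weight 2 to weight 1. *)
Lemma no_drop f u v g : stuck f -> f u v = z -> v != mt u -> reach C f g ->
  ~ drop_edge f g u v.
Proof.
move=> sf fuv vu rg dg; have vf := st_valid sf.
have uv := z_neq vf fuv.
have m x : x \in [:: u; v] -> miss g x z.
  rewrite !inE => xuv; apply/missP => y /eqP; rewrite dg => /andP[/eqP fxy].
  case/orP: xuv fxy => /eqP-> fxy; rewrite eqxx /= negb_or => /andP[].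
    by rewrite (vinj vf (x := u) (y := y) (y' := v)) ?fxy // eqxx.
  by move=> _; rewrite (vinj vf (x := v) (y := y) (y' := u)) ?eqxx ?fxy // (vsym vf).
have := st_min sf rg; rewrite (@mu_local _ _ [:: u; v]) ?big_cons ?big_nil /= ?inE ?uv //.
  rewrite (wt_bad vf fuv vu) (wt_bad (x := v) (y := u) vf) ?(vsym vf v u) //; last first.
    by apply: contraNneq vu => ->; rewrite mtK.
  by rewrite !wt_free ?m ?inE ?eqxx ?orbT.
move=> x; rewrite !inE negb_or => /andP[/negPf xu /negPf xv].
by apply/esym/eq_wt => y; rewrite dg xu xv andbT.
Qed.

(** Otherwise the one-edge fan [uv] could take the colour [b]. *)
Lemma not_bad_common f u v b : stuck f -> f u v = z -> v != mt u ->
  b \in O -> miss f u b -> ~~ miss f v b.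
Proof.
move=> sf fuv vu bO mu; apply/negP => mv.
have F : fan f u v (fun=> v) 0 by split=> // [[|i] [|j]].
have [g rg dg] := fan_shift (st_valid sf) fuv F bO mu mv.
exact: no_drop sf fuv vu rg dg.
Qed.

(** Otherwise a switch at [v] would give both ends the missing colour [a]. *)
Lemma bad_linked f u v a b : stuck f -> f u v = z -> v != mt u ->
  a \in O -> b \in O -> miss f u a -> miss f v b -> v \in kcomp f a b u.
Proof.
move=> sf fuv vu aO bO mu mv; apply: contraT => nuv.
have uv : u \notin kcomp f a b v by rewrite (kcomp_sym (st_valid sf)).
have sg := stuck_ord sf aO bO (@kcomp_closed _ f a b v).
have := not_bad_common sg (u := u) (v := v) _ vu aO.
rewrite miss_out // miss_in ?kcomp_refl // swapL flip_out // => /(_ fuv mu).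
by rewrite mv.
Qed.

(** Otherwise the matching edge at [x] is a component by itself and could take [z]. *)
Lemma not_both_free f x : stuck f -> miss f x z -> ~~ miss f (mt x) z.
Proof.
move=> sf mx; apply/negP => my; have vf := st_valid sf.
set a := f x (mt x); have aO : a \in O.
  by have := vcol vf (st_mt sf x); rewrite inE (negPf (miss_neq _ mx)).
have ma : f (mt x) x = a by rewrite (vsym vf).
have cl : kclosed f z a [set u in [:: x; mt x]].
  apply: kclosed_seq; rewrite /= (inside_miss _ mx) (inside_miss _ my).
  rewrite (inside_edge vf (palette_ord aO) (erefl a)) ?(inside_edge vf (palette_ord aO) ma) //;
  by rewrite !inE eqxx ?orbT.
have U : uniq [:: x; mt x] by rewrite /= inE eq_sym mt_neq.
have := stuck_sum sf (palette_ord aO) U cl.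
rewrite !big_cons !big_nil (wt_free mx) (wt_free my) wt_good; last first.
  by rewrite flip_in ?inE ?eqxx // -/a swapR.
rewrite wt_good // mtK flip_in; last by rewrite !inE eqxx orbT.
by rewrite ma swapR.
Qed.

(** The path [v u w] is a z/b-component, and its switch moves [z] from [uv] to [uw]. The weights of
    [v], [u], [w] are 2, 2, 1 before and at most 1, 2, 2 after, so minimality survives. *)
Lemma shift f u v w b : stuck f -> f u v = z -> v != mt u -> b \in O -> miss f v b ->
  f u w = b -> miss f w z -> stuck (flip f z b [set x in [:: v; u; w]]).
Proof.
move=> sf fuv vu bO mv fuw mw; have vf := st_valid sf; have bC := palette_ord bO.
have fvu : f v u = z by rewrite (vsym vf).
have fwu : f w u = b by rewrite (vsym vf).
have vw : v != w by apply: contraNneq zO => e; rewrite -fuv e fuw.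
have uw : u != w by apply/eqP => e; move: fuw (ord_neq0 bO); rewrite -e (virr vf) => <-.
have uv := z_neq vf fuv.
apply: stuck_flip => //.
  apply: kclosed_seq; rewrite /= (inside_miss _ mv) (inside_miss _ mw).
  rewrite (inside_edge vf zC fvu) ?(inside_edge vf zC fuv)
    ?(inside_edge vf bC fuw) ?(inside_edge vf bC fwu) //;
  by rewrite !inE eqxx ?orbT.
rewrite mu_flip; last by rewrite /= !inE negb_or vw uw eq_sym uv.
rewrite !big_cons !big_nil (wt_bad vf fuv vu) (wt_bad vf fvu); last first.
  by apply: contraNneq vu => ->; rewrite mtK.
rewrite (wt_free mw) wt_free; last by rewrite miss_in ?swapL // !inE eqxx.
set g := flip _ _ _ _; move: (wt_le2 g u) (wt_le2 g w); clear; lia.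
Qed.

(* The path [p q r] ends a component of the symmetric difference of the z-class and [mt]. *)
Record end_conf f p q r a b c : Prop := EndConf {
  ec_stuck : stuck f;
  ec_p : miss f p z;
  ec_pq : mt p = q;
  ec_qr : f q r = z;
  ec_a : f p q = a;
  ec_bO : b \in O;
  ec_cO : c \in O;
  ec_b : miss f r b;
  ec_c : miss f q c }.

(** * End configurations *)

Section EndConf.
Variables (f : T -> T -> nat) (p q r : T) (a b c : nat).
Hypothesis E : end_conf f p q r a b c.

Let sf := ec_stuck E.
Let vf := st_valid sf.

Lemma ec_aO : a \in O.
Proof.
have := vcol vf (st_mt sf p); rewrite (ec_pq E) (ec_a E) inE => /predU1P[] // e.
by have := miss_neq q (ec_p E); rewrite (ec_a E) e eqxx.
Qed.

Lemma ec_qp : f q p = a.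
Proof. by rewrite (vsym vf) (ec_a E). Qed.

Lemma ec_rq : f r q = z.
Proof. by rewrite (vsym vf) (ec_qr E). Qed.

Lemma ec_npq : p != q.
Proof. by rewrite -(ec_pq E) eq_sym mt_neq. Qed.

Lemma ec_nqr : q != r.
Proof. exact: z_neq vf (ec_qr E). Qed.

Lemma ec_nrq : r != q.
Proof. by rewrite eq_sym ec_nqr. Qed.

Lemma ec_npr : p != r.
Proof.
by apply: contraTneq (ec_p E) => ->; apply/negP => /missP/(_ q); rewrite ec_rq.
Qed.

Lemma ec_mq : mt q = p.
Proof. by rewrite -(ec_pq E) mtK. Qed.

Lemma ec_bad_qr : r != mt q.
Proof. by rewrite ec_mq eq_sym ec_npr. Qed.

Lemma ec_bad_rq : q != mt r.
Proof. by apply: contraNneq ec_bad_qr => ->; rewrite mtK. Qed.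

Lemma ec_ac : a != c.
Proof. by rewrite -ec_qp; apply: miss_neq (ec_c E). Qed.

Lemma ec_bc : b != c.
Proof.
apply: contraTneq (ec_c E) => <-.
exact: not_bad_common sf ec_rq ec_bad_rq (ec_bO E) (ec_b E).
Qed.

Lemma ec_link_bc : q \in kcomp f b c r.
Proof. exact: bad_linked sf ec_rq ec_bad_rq (ec_bO E) (ec_cO E) (ec_b E) (ec_c E). Qed.

(** If [a = b], then [p q r] is a z/a-component whose switch lowers the weights 1, 2, 2 to 0, 0,
    1. *)
Lemma ec_ab : a != b.
Proof.
apply/eqP => ab; have mr := ec_b E; rewrite -ab in mr.
have aC := palette_ord ec_aO.
have cl : kclosed f z a [set u in [:: p; q; r]].
  apply: kclosed_seq; rewrite /= (inside_miss _ (ec_p E)) (inside_miss _ mr).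
  rewrite (inside_edge vf zC (ec_qr E)) ?(inside_edge vf zC ec_rq)
    ?(inside_edge vf aC (ec_a E)) ?(inside_edge vf aC ec_qp) //; by rewrite !inE eqxx ?orbT.
have U : uniq [:: p; q; r] by rewrite /= !inE negb_or ec_npq ec_npr ec_nqr.
have := stuck_sum sf aC U cl.
rewrite !big_cons !big_nil (wt_free (ec_p E)) (wt_bad vf (ec_qr E) ec_bad_qr)
  (wt_bad vf ec_rq ec_bad_rq).
rewrite wt_good; last by rewrite (ec_pq E) flip_in ?inE ?eqxx // (ec_a E) swapR.
rewrite wt_good; last by rewrite ec_mq flip_in ?inE ?eqxx ?orbT // ec_qp swapR.
by rewrite wt_free // miss_in ?swapL // !inE eqxx !orbT.
Qed.


Lemma ec_r_c : ~~ miss f r c.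
Proof.
by apply: contraTN (ec_c E) => m; apply: not_bad_common sf ec_rq ec_bad_rq (ec_cO E) m.
Qed.

Lemma ec_q_b : ~~ miss f q b.
Proof. exact: not_bad_common sf ec_rq ec_bad_rq (ec_bO E) (ec_b E). Qed.

(** Otherwise shifting [z] from [rq] to [rw] would leave both ends of the matching edge [pq] without
    [z]. *)
Lemma ec_rc_free w : f r w = c -> miss f w z -> w = p.
Proof.
move=> rw mw; apply/eqP; apply: contraT => wp.
have sg := shift sf ec_rq ec_bad_rq (ec_cO E) (ec_c E) rw mw.
have := not_both_free (x := p) sg; rewrite (ec_pq E) miss_out; last first.
  by rewrite !inE !negb_or ec_npq ec_npr eq_sym.
by rewrite miss_in ?swapL ?(ec_c E) ?(ec_p E) ?inE ?eqxx // => /(_ isT).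
Qed.

(** Otherwise [rw] is the whole b/c-component of [r], although [q] belongs to it. *)
Lemma ec_rc_b w : f r w = c -> ~~ miss f w b.
Proof.
move=> rw; apply/negP => mw; have cC := palette_ord (ec_cO E).
have := kcomp_sub (kclosedC (kclosed2 vf cC rw (ec_b E) mw)) _ ec_link_bc.
rewrite !inE eqxx => /(_ isT); rewrite (negPf ec_nqr) /= => /eqP qw.
by move: zO; rewrite -ec_rq qw rw (ec_cO E).
Qed.

End EndConf.

(** Ordinary switches do not move the z-class, so only the ordinary colours of the configuration
    need a new check. *)
Lemma end_flip f p q r a b c k l K a' b' c' : end_conf f p q r a b c ->
  k \in O -> l \in O -> kclosed f k l K -> b' \in O -> c' \in O ->
  miss (flip f k l K) r b' -> miss (flip f k l K) q c' ->
  flip f k l K p q = a' ->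
  end_conf (flip f k l K) p q r a' b' c'.
Proof.
move=> [sf mp pq qr fa bO cO mr mq] kO lO cl b'O c'O mr' mq' a'E; split=> //.
- exact: stuck_ord.
- by rewrite miss_other // eq_sym ord_neqz.
- by apply: flip_keep => //; rewrite eq_sym ord_neqz.
Qed.

(** Otherwise a switch at [r] avoids [q], hence [p], and makes [r] miss [a], against [ec_ab]. *)
Lemma ec_link_ab f p q r a b c : end_conf f p q r a b c -> q \in kcomp f a b r.
Proof.
move=> E; apply: contraT => qK; have aO := ec_aO E.
have pK : p \notin kcomp f a b r.
  by apply: contra qK; apply: kcomp_edge; rewrite (ec_a E) mem_head.
have := end_flip (a' := a) (b' := a) (c' := c) E aO (ec_bO E) (@kcomp_closed _ f a b r) aO (ec_cO E).
rewrite miss_in ?kcomp_refl // swapL miss_out // flip_out //.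
by move=> /(_ (ec_b E) (ec_c E) (ec_a E)) /ec_ab; rewrite eqxx.
Qed.

Lemma ec_h f p q r a b c : end_conf f p q r a b c -> exists h, f r h = a.
Proof.
move=> E; apply: missPn; apply/negP => m.
have [sf mp pq qr fa _ cO _ mq] := E.
by have := ec_ab (EndConf sf mp pq qr fa (ec_aO E) cO m mq); rewrite eqxx.
Qed.

Section EndH.
Variables (f : T -> T -> nat) (p q r h : T) (a b c : nat).
Hypotheses (E : end_conf f p q r a b c) (rh : f r h = a).

Let sf := ec_stuck E.
Let vf := st_valid sf.
Let aO := ec_aO E.

Lemma eh_hr : f h r = a.
Proof. by rewrite (vsym vf). Qed.

Lemma eh_nhr : h != r.
Proof. by apply: contraNneq O0 => e; rewrite -(virr vf r) -{2}e rh. Qed.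

Lemma eh_nhq : h != q.
Proof. by apply: contraNneq zO => e; rewrite -(ec_rq E) -e rh. Qed.

Lemma eh_nhp : h != p.
Proof.
apply: contraNneq (ec_nqr E) => e; apply/eqP/(vinj vf (x := p)).
  by rewrite (ec_a E) -e eh_hr.
by rewrite (ec_a E) ord_neq0.
Qed.

(** Otherwise [p q r h] is a z/a-component, with weights 1, 2, 2, 1 before the switch and at most 0,
    0, 2, 2 after it. *)
Lemma eh_z : ~~ miss f h z.
Proof.
apply/negP => mh; have aC := palette_ord aO.
have cl : kclosed f z a [set u in [:: p; q; r; h]].
  apply: kclosed_seq; rewrite /= (inside_miss _ (ec_p E)) (inside_miss _ mh).
  rewrite (inside_edge vf zC (ec_qr E)) ?(inside_edge vf zC (ec_rq E))
    ?(inside_edge vf aC (ec_a E)) ?(inside_edge vf aC (ec_qp E))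
    ?(inside_edge vf aC rh) ?(inside_edge vf aC eh_hr) //; by rewrite !inE eqxx ?orbT.
have U : uniq [:: p; q; r; h].
  rewrite /= !inE !negb_or (ec_npq E) (ec_npr E) (ec_nqr E).
  by rewrite ![_ == h]eq_sym eh_nhr eh_nhq eh_nhp.
have := stuck_sum sf aC U cl.
rewrite !big_cons !big_nil (wt_free (ec_p E)) (wt_bad vf (ec_qr E) (ec_bad_qr E))
  (wt_bad vf (ec_rq E) (ec_bad_rq E)) (wt_free mh).
rewrite (wt_good (x := p)); last by rewrite (ec_pq E) flip_in ?inE ?eqxx // (ec_a E) swapR.
rewrite (wt_good (x := q)); last first.
  by rewrite (ec_mq E) flip_in ?inE ?eqxx ?orbT // (ec_qp E) swapR.
set g := flip _ _ _ _.
by move: (wt_le2 g r) (wt_le2 g h); clear; lia.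
Qed.

Lemma eh_b : ~~ miss f h b.
Proof.
apply/negP => mh.
have := kcomp_sub (kclosed2 vf (palette_ord aO) rh (ec_b E) mh) _ (ec_link_ab E).
by rewrite !inE eqxx (negPf (ec_nqr E)) [q == h]eq_sym (negPf eh_nhq) => /(_ isT).
Qed.

End EndH.

(** The b/c-path of [r] ends at [q], so a switch at [h] would avoid both and make [h] miss [b],
    against [eh_b]. *)
Lemma eh_c f p q r h a b c : end_conf f p q r a b c -> f r h = a -> ~~ miss f h c.
Proof.
move=> E rh; apply/negP => mh; have [bO cO] := (ec_bO E, ec_cO E).
have vf := st_valid (ec_stuck E).
have nh : h \notin kcomp f b c r.
  apply: (three_ends vf _ _ _ _ _ (ec_link_bc E));
  by rewrite ?ord_neq0 ?(ec_b E) ?(ec_c E) ?mh ?orbT ?(ec_nrq E) ?(eh_nhr E rh) ?(eh_nhq E rh).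
have rK : r \notin kcomp f b c h by rewrite (kcomp_sym vf).
have qK := kcomp_notin vf (ec_link_bc E) nh.
have [ba ca] : b != a /\ c != a by rewrite eq_sym (ec_ab E) eq_sym (ec_ac E).
have [ab ac] := (ec_ab E, ec_ac E).
have E' : end_conf (flip f b c (kcomp f b c h)) p q r a b c.
  apply: (end_flip E) => //; first exact: kcomp_closed.
  - by rewrite miss_out ?(ec_b E).
  - by rewrite miss_out ?(ec_c E).
  - by apply: flip_keep => //; apply: ec_a E.
have := eh_b E' (flip_keep _ ab ac rh).
by rewrite miss_in ?kcomp_refl // swapL mh.
Qed.

(* [a], [b], [c], [d] exhaust [O] by [fc_cover]: this is where the degree bound 4 enters. *)
Record full_conf f p q r h a b c d : Prop := FullConf {
  fc_end : end_conf f p q r a b c;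
  fc_h : f r h = a;
  fc_dO : d \in O;
  fc_d : miss f h d }.

(** * Switches that keep the path [p q r h] *)

Section FullConf.
Variables (f : T -> T -> nat) (p q r h : T) (a b c d : nat).
Hypothesis F : full_conf f p q r h a b c d.

Let E := fc_end F.
Let rh := fc_h F.
Let dO := fc_dO F.
Let hd := fc_d F.
Let sf := ec_stuck E.
Let vf := st_valid sf.
Let aO := ec_aO E.
Let bO := ec_bO E.
Let cO := ec_cO E.
Let ab := ec_ab E.
Let ac := ec_ac E.
Let bc := ec_bc E.
Let ba : b != a. Proof. by rewrite eq_sym. Qed.
Let ca : c != a. Proof. by rewrite eq_sym. Qed.
Let cb : c != b. Proof. by rewrite eq_sym. Qed.
Hint Resolve sf vf aO bO cO ab ac bc ba ca cb kcomp_closed kcomp_refl : core.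

Lemma fc_ad : a != d.
Proof. by rewrite -(eh_hr E rh); apply: miss_neq hd. Qed.

Lemma fc_bd : b != d.
Proof. by apply: contraTneq hd => <-; apply: eh_b E rh. Qed.

Lemma fc_cd : c != d.
Proof. by apply: contraTneq hd => <-; apply: eh_c E rh. Qed.

Let ad := fc_ad.
Let bd := fc_bd.
Let cd := fc_cd.
Let da : d != a. Proof. by rewrite eq_sym. Qed.
Let db : d != b. Proof. by rewrite eq_sym. Qed.
Let dc : d != c. Proof. by rewrite eq_sym. Qed.
Hint Resolve ad bd cd da db dc : core.

Lemma fc_neqs : [/\ [/\ a != b, a != c & a != d], [/\ b != a, b != c & b != d],
  [/\ c != a, c != b & c != d] & [/\ d != a, d != b & d != c]].
Proof. by []. Qed.

Lemma fc_cover e : e \in O -> e \in [:: a; b; c; d].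
Proof.
have U : uniq [:: a; b; c; d].
  by rewrite /= !inE !negb_or ab ac fc_ad bc fc_bd fc_cd.
have sub : {subset [:: a; b; c; d] <= O}.
  by move=> x; rewrite !inE => /or4P[] /eqP->.
by have [_ ->] := uniq_min_size U sub sizeO.
Qed.

Lemma fc_r_d : ~~ miss f r d.
Proof.
apply: contraTN hd => m; have [_ mp pq qr fa _ _ _ mq] := E.
exact: eh_b (EndConf sf mp pq qr fa dO cO m mq) rh.
Qed.

(** Otherwise a switch at [h] makes [h] miss [b] while [r] still misses it, against [eh_b]. *)
Lemma fc_link_bd : h \in kcomp f b d r.
Proof.
apply: contraT => nh; have rK : r \notin kcomp f b d h by rewrite (kcomp_sym vf).
have E' : end_conf (flip f b d (kcomp f b d h)) p q r a b c.
  apply: (end_flip E) => //.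
  - by rewrite miss_out ?(ec_b E).
  - by rewrite miss_other ?(ec_c E).
  - by apply: flip_keep => //; apply: ec_a E.
have := eh_b E' (flip_keep _ ab ad rh).
by rewrite miss_in // swapL hd.
Qed.

Lemma fc_rd_b w : f r w = d -> ~~ miss f w b.
Proof.
move=> rw; apply/negP => mw; have dC := palette_ord dO.
have := kcomp_sub (kclosedC (kclosed2 vf dC rw (ec_b E) mw)) _ fc_link_bd.
rewrite !inE eqxx => /(_ isT); rewrite (negPf (eh_nhr E rh)) /= => /eqP hw.
by case/eqP: ad; rewrite -rh hw.
Qed.


(** The a/b-component of [r] contains [q], and also [p] and [h] through the [a]-edges [pq] and
    [rh]. *)
Lemma fc_flip_ab w : w \notin kcomp f a b r ->
  full_conf (flip f a b (kcomp f a b w)) p q r h a b c d /\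
  [/\ p \notin kcomp f a b w, q \notin kcomp f a b w,
      r \notin kcomp f a b w & h \notin kcomp f a b w].
Proof.
move=> nw; have rK : r \notin kcomp f a b w by rewrite (kcomp_sym vf).
have qK := kcomp_notin vf (ec_link_ab E) nw.
have pK : p \notin kcomp f a b w by apply: (kcomp_nedge vf _ qK); rewrite (ec_qp E) mem_head.
have hK : h \notin kcomp f a b w by apply: (kcomp_nedge vf _ rK); rewrite rh mem_head.
split=> //; split; rewrite ?miss_other ?flip_out //.
by apply: (end_flip E); rewrite ?miss_out ?flip_out ?(ec_b E) ?(ec_c E) ?(ec_a E).
Qed.

(** Only [r] and [q] have to be avoided: a b/c-switch affects neither the [a]-edges [pq] and [rh]
    nor the colour [d] missing at [h]. *)
Lemma fc_flip_bc w : w \notin kcomp f b c r ->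
  full_conf (flip f b c (kcomp f b c w)) p q r h a b c d /\
  q \notin kcomp f b c w /\ r \notin kcomp f b c w.
Proof.
move=> nw; have rK : r \notin kcomp f b c w by rewrite (kcomp_sym vf).
have qK := kcomp_notin vf (ec_link_bc E) nw.
split=> //; split; rewrite ?miss_other ?(flip_keep _ ab ac) //.
apply: (end_flip E); rewrite ?miss_out ?(ec_b E) ?(ec_c E) //.
by apply: flip_keep => //; apply: ec_a E.
Qed.

Lemma fc_flip_bd w : w \notin kcomp f b d r ->
  full_conf (flip f b d (kcomp f b d w)) p q r h a b c d /\
  r \notin kcomp f b d w /\ h \notin kcomp f b d w.
Proof.
move=> nw; have rK : r \notin kcomp f b d w by rewrite (kcomp_sym vf).
have hK := kcomp_notin vf fc_link_bd nw.
split=> //; split; rewrite ?miss_out ?flip_out //.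
apply: (end_flip E); rewrite ?(miss_out _ _ _ _ rK) ?(ec_b E) ?miss_other ?(ec_c E) //.
by apply: flip_keep => //; apply: ec_a E.
Qed.

End FullConf.

(** * The [c]- and [d]-neighbours of [r] *)

Section Improvements.
Variables (f : T -> T -> nat) (p q r h : T) (a b c d : nat).
Hypothesis F : full_conf f p q r h a b c d.

Let E := fc_end F.
Let rh := fc_h F.
Let dO := fc_dO F.
Let hd := fc_d F.
Let sf := ec_stuck E.
Let vf := st_valid sf.
Let aO := ec_aO E.
Let bO := ec_bO E.
Let cO := ec_cO E.
Hint Resolve sf vf aO bO cO dO kcomp_closed kcomp_refl : core.

(** By [ec_rc_b], [w] does not miss [b], even after switches that keep the configuration. A missing
    [d] would become [b] by a b/d-switch at [w], and so would a missing [a] by an a/b-switch if [w]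
    were not linked to [r]. *)
Lemma fc_rc w : f r w = c -> ~~ miss f w z -> miss f w a /\ w \in kcomp f a b r.
Proof.
have [[ab ac ad] [ba bc bd] [ca cb cd] [da db dc]] := fc_neqs F.
move=> rw wz; have [e eO me] := stuck_ordinary sf wz.
have wr : f w r = c by rewrite (vsym vf).
have nwr : w != r by apply: contraNneq O0 => e0; rewrite -(virr vf r) -{2}e0 rw.
have nwh : w != h by apply: contraNneq ca => e0; rewrite -rw e0 rh.
have wa : miss f w a.
  have := fc_cover F eO; rewrite !inE => /or4P[] /eqP eE; rewrite eE in me => //.
  - by have := ec_rc_b E rw; rewrite me.
  - by have := miss_neq r me; rewrite wr eqxx.
  have [] := fc_flip_bd F (w := w).
    apply: (three_ends vf _ _ _ _ _ (fc_link_bd F));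
    by rewrite ?ord_neq0 ?(ec_b E) ?hd ?me ?orbT // eq_sym (eh_nhr E rh).
  move=> F' _; have := ec_rc_b (fc_end F') (flip_keep _ cb cd rw).
  by rewrite miss_in // swapL me.
split=> //; apply: contraT => /(fc_flip_ab F)[F' _].
have := ec_rc_b (fc_end F') (flip_keep _ ca cb rw).
by rewrite miss_in // swapR wa.
Qed.

Lemma fc_rd w : f r w = d -> ~~ miss f w z -> miss f w a /\ w \in kcomp f a b r.
Proof.
have [[ab ac ad] [ba bc bd] [ca cb cd] [da db dc]] := fc_neqs F.
move=> rw wz; have [e eO me] := stuck_ordinary sf wz.
have wr : f w r = d by rewrite (vsym vf).
have nwr : w != r by apply: contraNneq O0 => e0; rewrite -(virr vf r) -{2}e0 rw.
have nwq : w != q by apply: contraNneq zO => e0; rewrite -(ec_rq E) -e0 rw.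
have wa : miss f w a.
  have := fc_cover F eO; rewrite !inE => /or4P[] /eqP eE; rewrite eE in me => //.
  - by have := fc_rd_b F rw; rewrite me.
  - have [] := fc_flip_bc F (w := w).
      apply: (three_ends vf _ _ _ _ _ (ec_link_bc E)); 
      by rewrite ?ord_neq0 ?(ec_b E) ?(ec_c E) ?me ?orbT ?(ec_nrq E).
    move=> F' _; have := fc_rd_b F' (flip_keep _ db dc rw).
    by rewrite miss_in // swapL me.
  - by have := miss_neq r me; rewrite wr eqxx.
split=> //; apply: contraT => /(fc_flip_ab F)[F' _].
have := fc_rd_b F' (flip_keep _ da db rw).
by rewrite miss_in // swapR wa.
Qed.

Lemma fc_w1 : exists w, f r w = c.
Proof. by apply: missPn; apply: ec_r_c E. Qed.

Lemma fc_w2 : exists w, f r w = d.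
Proof. by apply: missPn; apply: fc_r_d F. Qed.

Lemma fc_s : exists s, f h s = z.
Proof. by apply: missPn; apply: eh_z E rh. Qed.

(* Otherwise [p q r h s] is a z/a-component; its switch puts [pq] into the z-class in
   place of [qr] and trades [hs] for [rh]. If this is not an improvement then [hs] is a
   matching edge, and a fan at [r] removes [rh] from the z-class. *)
Lemma core_a s : f h s = z -> ~~ miss f s a.
Proof.
have [[ab ac ad] [ba bc bd] [ca cb cd] [da db dc]] := fc_neqs F.
move=> hs; apply/negP => ms; have [w1 rw1] := fc_w1; have [w2 rw2] := fc_w2.
have [az bz cz dz] : [/\ a != z, b != z, c != z & d != z] by rewrite !ord_neqz.
have aC := palette_ord aO; have sh : f s h = z by rewrite (vsym vf).
have nsr : s != r by apply: contraNneq az => e; rewrite -(eh_hr E rh) -e hs.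
have nsh : s != h by rewrite eq_sym (z_neq vf hs).
have nsp : s != p.
  by apply: contraTneq (ec_p E) => <-; apply/negP => /missP/(_ h).
have nsq : s != q.
  apply: contraNneq (eh_nhr E rh) => e; apply/eqP/(vinj vf (x := q)).
    by rewrite -{1}e sh (ec_qr E).
  by rewrite -e sh.
have U : uniq [:: p; q; r; h; s].
  rewrite /= !inE !negb_or (ec_npq E) (ec_npr E) (ec_nqr E).
  rewrite ![_ == h]eq_sym ![_ == s]eq_sym nsr nsp nsq nsh.
  by rewrite (eh_nhr E rh) (eh_nhq E rh) (eh_nhp E rh).
set L := [:: p; q; r; h; s] in U *.
have cl : kclosed f z a [set u in L].
  apply: kclosed_seq; rewrite /= (inside_miss _ (ec_p E)) (inside_miss _ ms).
  rewrite (inside_edge vf zC (ec_qr E)) ?(inside_edge vf zC (ec_rq E))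
    ?(inside_edge vf aC (ec_a E)) ?(inside_edge vf aC (ec_qp E))
    ?(inside_edge vf aC rh) ?(inside_edge vf aC (eh_hr E rh))
    ?(inside_edge vf zC hs) ?(inside_edge vf zC sh) //; by rewrite !inE eqxx ?orbT.
set g := flip f z a [set u in L].
have gE x y : x \in L -> g x y = swap z a (f x y) by move=> xL; rewrite /g flip_in // inE.
have gout x e : x \notin L -> miss g x e = miss f x e.
  by move=> xL; rewrite /g miss_out // inE.
have [pL qL rL hL sL] : [/\ p \in L, q \in L, r \in L, h \in L & s \in L].
  by rewrite /L !inE !eqxx ?orbT.
have gp : wt g p = 0 by apply: wt_good; rewrite (ec_pq E) gE // (ec_a E) swapR.
have gq : wt g q = 0 by apply: wt_good; rewrite (ec_mq E) gE // (ec_qp E) swapR.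
have ms' : miss g s z by rewrite /g miss_in ?swapL // inE.
have sums := stuck_sum sf aC U cl; rewrite -/g in sums.
(* If [hs] is a wrong edge too, the weights 1, 2, 2, 2, 2 drop to at most 0, 0, 2, 2, 1. *)
have [hs_mt|nhs] := eqVneq s (mt h); last first.
  rewrite !big_cons !big_nil (wt_free (ec_p E)) (wt_bad vf (ec_qr E) (ec_bad_qr E))
    (wt_bad vf (ec_rq E) (ec_bad_rq E)) (wt_bad vf hs nhs) (wt_bad vf sh) in sums; last first.
    by apply: contraNneq nhs => ->; rewrite mtK.
  rewrite gp gq (wt_free ms') in sums.
  by move: sums (wt_le2 g r) (wt_le2 g h); clear; lia.
have mts : mt s = h by rewrite hs_mt mtK.
(* The five weights sum to at least 5 in [f] and to at most 5 in [g]. *)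
have sg : stuck g.
  apply: stuck_flip => //; rewrite mu_flip // -/g !big_cons !big_nil.
  rewrite (wt_free (ec_p E)) (wt_bad vf (ec_qr E) (ec_bad_qr E)).
  rewrite (wt_bad vf (ec_rq E) (ec_bad_rq E)).
  rewrite gp gq (wt_free ms').
  by move: (wt_le2 g r) (wt_le2 g h); clear; lia.
have vg := st_valid sg.
(* In [g] the free vertex is [s], its partner is [h] and the wrong edge is [hr]; [d] takes the role
   of [c]. *)
have EG : end_conf g s h r a b d.
  split=> //.
  - by rewrite gE // (eh_hr E rh) swapR.
  - by rewrite gE // sh swapL.
  - by rewrite /g miss_other // (ec_b E).
  - by rewrite /g miss_other.
have bad_rh : h != mt r by apply: contraNneq nsr => e; apply/eqP/mt_inj; rewrite mts.
have grh : g r h = z by rewrite gE // rh swapR.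
have gr1 : g r w1 = c by apply: flip_keep.
have gr2 : g r w2 = d by apply: flip_keep.
have w2_free : miss g w2 z -> w2 = s by exact: (ec_rc_free EG gr2).
have w1L : w1 \notin [:: p; s] -> w1 \notin L.
  rewrite /L !inE !negb_or => /andP[-> ->]; rewrite andbT /=; apply/and3P; split.
  - by apply: contraNneq cz => e; rewrite -rw1 e (ec_rq E).
  - by apply: contraNneq O0 => e; rewrite -(virr vf r) -{2}e rw1.
  - by apply: contraNneq ca => e; rewrite -rw1 e rh.
have w2L : w2 \notin [:: p; s] -> w2 \notin L.
  rewrite /L !inE !negb_or => /andP[-> ->]; rewrite andbT /=; apply/and3P; split.
  - by apply: contraNneq dz => e; rewrite -rw2 e (ec_rq E).
  - by apply: contraNneq O0 => e; rewrite -(virr vf r) -{2}e rw2.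
  - by apply: contraNneq da => e; rewrite -rw2 e rh.
have w12 : w1 != w2 by apply: contraNneq cd => e; rewrite -rw1 e rw2.
have w1_free : miss g w1 z -> w1 = s.
  move=> m; apply/eqP; apply: contraT => nw1s.
  have [w1p|nw1p] := eqVneq w1 p.
    by have := miss_neq q m; rewrite w1p gE // (ec_a E) swapR eqxx.
  have w1nL : w1 \notin L by apply: w1L; rewrite !inE negb_or nw1p.
  move: m; rewrite gout // => /(ec_rc_free E rw1) w1p.
  by rewrite w1p eqxx in nw1p.
(* The a/b-path of [r], which misses [b], has only one other end. *)
have link_end w w' : w != w' -> w \in kcomp f a b r -> w' \in kcomp f a b r ->
    miss f w a -> miss f w' a -> r != w -> r != w' -> False.
  move=> ww' l l' m m' rw rw'.
  have := three_ends vf (ord_neq0 aO) (ord_neq0 bO) (x := r) (y := w) (w := w').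
  rewrite (ec_b E) m m' l l' !orbT rw ![w' == _]eq_sym rw' ww'.
  by move=> /(_ isT isT isT isT isT isT isT).
have rw1n : r != w1 by apply: contraNneq O0 => e; rewrite -(virr vf r) {2}e rw1.
have rw2n : r != w2 by apply: contraNneq O0 => e; rewrite -(virr vf r) {2}e rw2.
(* Otherwise every neighbour of [r] misses an ordinary colour in [g], and a fan at [r] removes the
   wrong edge [rh]. *)
have : (w1 == s) || (w2 == s).
  apply: contraT; rewrite negb_or => /andP[n1 n2].
  have [|g' rg dg] := vizing_fan vg grh bO (ec_b EG).
    move=> y ry; have := vcol vg ry; rewrite inE => /predU1P[ez|eO].
      exists d => //; rewrite (vinj vg (x := r) (y := y) (y' := h)) ?ez ?grh //.
      by rewrite /g miss_other.
    have := fc_cover F eO; rewrite !inE => /or4P[] /eqP e.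
    - exists c => //; rewrite (vinj vg (x := r) (y := y) (y' := q)) //.
        by rewrite /g miss_other // (ec_c E).
      by rewrite e gE // (ec_rq E) swapL.
    - by have := miss_neq y (ec_b EG); rewrite e eqxx.
    - apply: stuck_ordinary sg _; apply: contra n1 => m; apply/eqP.
      have yw : y = w1 by exact: (vinj vg (etrans e (esym gr1)) ry).
      by apply: w1_free; rewrite -yw.
    - apply: stuck_ordinary sg _; apply: contra n2 => m; apply/eqP.
      have yw : y = w2 by exact: (vinj vg (etrans e (esym gr2)) ry).
      by apply: w2_free; rewrite -yw.
  by case: (no_drop sg grh bad_rh rg dg).
(* The partner of [r] can only be joined to it in colour [c] or [d], so it is [w1] or [w2]; but [p]
   and [s] have the partners [q] and [h]. *)
have partner : w1 \in [:: p; s] -> w2 \in [:: p; s] -> False.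
  have mtm m : m \in [:: p; s] -> mt r = m -> False.
    rewrite !inE => /orP[] /eqP-> /(congr1 mt); rewrite mtK ?(ec_pq E) ?mts => e.
      by have := ec_nrq E; rewrite e eqxx.
    by have := eh_nhr E rh; rewrite e eqxx.
  move=> i1 i2; have rm0 := st_mt sf r.
  have := vcol vf rm0; rewrite inE => /predU1P[ez|eO].
    have e := vinj vf (etrans ez (esym (ec_rq E))) rm0.
    by move: (ec_bad_rq E); rewrite e eqxx.
  have := fc_cover F eO; rewrite !inE => /or4P[] /eqP e.
  - by move: bad_rh; rewrite (vinj vf (etrans e (esym rh)) rm0) eqxx.
  - by have := miss_neq (mt r) (ec_b E); rewrite e eqxx.
  - exact: mtm i1 (vinj vf (etrans e (esym rw1)) rm0).
  - exact: mtm i2 (vinj vf (etrans e (esym rw2)) rm0).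
have sz : ~~ miss f s z by apply/negP => /missP/(_ h).
(* The vertex equal to [s] is the other end of the a/b-path of [r]. The remaining one is either [p],
   excluded by [partner], or a third end. *)
case/orP=> /eqP ws.
  have [_ l1] := fc_rc rw1 (etrans (congr1 (fun x => ~~ miss f x z) ws) sz).
  have [w2p|nw2p] := eqVneq w2 p.
    by apply: partner; rewrite ?ws ?w2p !inE eqxx ?orbT.
  have w2s : w2 != s by rewrite -ws eq_sym.
  have w2nL : w2 \notin L by apply: w2L; rewrite !inE negb_or nw2p.
  have [m2|/(fc_rd rw2)[m2 l2]] := boolP (miss f w2 z).
    by move: w2s; rewrite w2_free ?eqxx // gout.
  by apply: link_end l1 l2 _ m2 _ _ => //; rewrite ws.
have [m2 l2] := fc_rd rw2 (etrans (congr1 (fun x => ~~ miss f x z) ws) sz).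
have [w1p|nw1p] := eqVneq w1 p.
  by apply: partner; rewrite ?ws ?w1p !inE eqxx ?orbT.
have w1z : ~~ miss f w1 z by apply: contra nw1p => /(ec_rc_free E rw1) ->.
have [m1 l1] := fc_rc rw1 w1z.
exact: link_end l1 l2 m1 m2 _ _.
Qed.


Lemma fc_nsr s : f h s = z -> s != r.
Proof.
by move=> hs; apply: contraNneq zO => e; rewrite -hs e (eh_hr E rh).
Qed.

Lemma fc_nsq s : f h s = z -> s != q.
Proof.
move=> hs; have sh : f s h = z by rewrite (vsym vf).
apply: contraNneq (eh_nhr E rh) => e; apply/eqP/(vinj vf (x := q)).
  by rewrite -{1}e sh (ec_qr E).
by rewrite -e sh.
Qed.

Lemma fc_ordinary s : f h s = z -> exists2 e, e \in [:: a; b; c; d] & miss f s e.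
Proof.
move=> hs; have [|e eO me] := @stuck_ordinary f s sf; last by exists e; rewrite ?(fc_cover F).
by apply/negP => /missP/(_ h); rewrite (vsym vf).
Qed.

End Improvements.

(** The a/b-path of [r] ends at [t], and [s] differs from [t] by [core_a], so it lies off this path.
    A switch at [s] then makes it miss [a], against [core_a]. *)
Lemma core_b f p q r h a b c d s t : full_conf f p q r h a b c d ->
  t \in kcomp f a b r -> t != r -> miss f t a -> f h s = z -> ~~ miss f s b.
Proof.
move=> F tr ntr mt' hs; apply/negP => ms; have E := fc_end F.
have [[ab ac ad] [ba bc bd] [ca cb cd] [da db dc]] := fc_neqs F.
have vf := st_valid (ec_stuck E).
have [st|nst] := eqVneq s t; first by have := core_a F hs; rewrite st mt'.
have ns : s \notin kcomp f a b r.
  apply: (three_ends vf (ord_neq0 (ec_aO E)) (ord_neq0 (ec_bO E)) _ _ _ tr);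
  by rewrite ?(ec_b E) ?mt' ?ms ?orbT // ?(fc_nsr F hs) // eq_sym.
have [F' [_ _ _ hK]] := fc_flip_ab F ns.
have := core_a F' (s := s); rewrite flip_out // miss_in ?kcomp_refl // swapL ms.
by move/(_ hs).
Qed.

(* Such a [w] misses [a] and is the end other than [r] of the a/b-path of [r], so that
   [s] is not on this path. *)
Definition far_end f p r c d :=
  (exists2 w, f r w = c & w != p) \/ (exists2 w, f r w = d & ~~ miss f w z).

Lemma far_end_linked f p q r h a b c d : full_conf f p q r h a b c d ->
  far_end f p r c d -> exists t, [/\ t \in kcomp f a b r, t != r & miss f t a].
Proof.
move=> F; have E := fc_end F; have vf := st_valid (ec_stuck E).
have nr w e : e \in O -> f r w = e -> w != r.
  by move=> eO fe; apply: contraTneq eO => e0; rewrite -fe e0 (virr vf).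
case=> -[w rw wP].
  have wz : ~~ miss f w z by apply: contra wP => /(ec_rc_free E rw) ->.
  have [m l] := fc_rc F rw wz.
  by exists w; split=> //; apply: nr rw; apply: ec_cO E.
have [m l] := fc_rd F rw wP.
by exists w; split=> //; apply: nr rw; apply: fc_dO F.
Qed.

Lemma far_end_flip f p r c d k l K : k \in O -> l \in O -> r \notin K ->
  far_end f p r c d -> far_end (flip f k l K) p r c d.
Proof.
move=> kO lO rK [] [w rw wP]; [left|right]; exists w; rewrite ?flip_out //.
by rewrite miss_other // eq_sym ord_neqz.
Qed.

(** The vertex [s] misses an ordinary colour: not [a] by [core_a], not [b] by [core_b], and a
    missing [c] or [d] becomes [b] after a switch at [s] that stays off [r]. *)
Lemma no_far_end f p q r h a b c d : full_conf f p q r h a b c d -> ~ far_end f p r c d.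
Proof.
move=> F P; have E := fc_end F.
have [[ab ac ad] [ba bc bd] [ca cb cd] [da db dc]] := fc_neqs F.
have [s hs] := fc_s F; have vf := st_valid (ec_stuck E).
have [[aO bO] [cO dO]] := ((ec_aO E, ec_bO E), (ec_cO E, fc_dO F)).
have [bz cz dz] : [/\ z != b, z != c & z != d] by rewrite !(eq_sym z) !ord_neqz.
have case_b g : full_conf g p q r h a b c d -> far_end g p r c d -> g h s = z ->
    ~~ miss g s b.
  move=> G Pg ghs; have [t [tr ntr mt']] := far_end_linked G Pg.
  exact: core_b G tr ntr mt' ghs.
have [e] := fc_ordinary F hs; rewrite !inE => /or4P[] /eqP-> ms.
- by have := core_a F hs; rewrite ms.
- by have := case_b f F P hs; rewrite ms.
- have ns : s \notin kcomp f b c r.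
    apply: (three_ends vf (ord_neq0 bO) (ord_neq0 cO) _ _ _ (ec_link_bc E));
    by rewrite ?(ec_b E) ?(ec_c E) ?ms ?orbT ?(ec_nrq E) ?(fc_nsr F hs) ?(fc_nsq F hs).
  have [F' [qK rK]] := fc_flip_bc F ns.
  have := case_b _ F' (far_end_flip bO cO rK P) (flip_keep _ bz cz hs).
  by rewrite miss_in ?kcomp_refl // swapL ms.
have ns : s \notin kcomp f b d r.
  apply: (three_ends vf (ord_neq0 bO) (ord_neq0 dO) _ _ _ (fc_link_bd F));
  by rewrite ?(ec_b E) ?(fc_d F) ?ms ?orbT // ?(fc_nsr F hs) // eq_sym
     ?(eh_nhr E (fc_h F)) ?(z_neq vf hs).
have [F' [rK hK]] := fc_flip_bd F ns.
have := case_b _ F' (far_end_flip bO dO rK P) (flip_keep _ bz dz hs).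
by rewrite miss_in ?kcomp_refl // swapL ms.
Qed.

Lemma end_full f p q r a b c : end_conf f p q r a b c ->
  exists h d, full_conf f p q r h a b c d.
Proof.
move=> E; have [h rh] := ec_h E.
have [d dO hd] := stuck_ordinary (ec_stuck E) (eh_z E rh).
by exists h, d; split.
Qed.

(** Any other [c]-neighbour of [r] would be a far end. Thus [p q r] is a triangle. *)
Lemma end_rp f p q r a b c : end_conf f p q r a b c -> f r p = c.
Proof.
move=> E; have [h [d F]] := end_full E; have [w rw] := fc_w1 F.
have [<- //|nwp] := eqVneq w p; case: (no_far_end F); left; by exists w.
Qed.

(** Otherwise a switch at [q] lets [d] play the role of [c] while [h] still misses [d], against
    [eh_c]. *)
Lemma fc_link_cd f p q r h a b c d : full_conf f p q r h a b c d -> h \in kcomp f c d q.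
Proof.
move=> F; have E := fc_end F; apply: contraT => nh.
have [[ab ac ad] [ba bc bd] [ca cb cd] [da db dc]] := fc_neqs F.
have [[aO bO] [cO dO]] := ((ec_aO E, ec_bO E), (ec_cO E, fc_dO F)).
have E' : end_conf (flip f c d (kcomp f c d q)) p q r a b d.
  apply: (end_flip E) => //; first exact: kcomp_closed.
  - by rewrite miss_other // (ec_b E).
  - by rewrite miss_in ?kcomp_refl // swapR (ec_c E).
  - by apply: flip_keep => //; apply: ec_a E.
have := eh_c E' (flip_keep _ ac ad (fc_h F)).
by rewrite miss_out // (fc_d F).
Qed.

Lemma fc_flip_cd f p q r h a b c d w : full_conf f p q r h a b c d ->
  w \notin kcomp f c d q -> full_conf (flip f c d (kcomp f c d w)) p q r h a b c d /\
  q \notin kcomp f c d w.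
Proof.
move=> F nw; have E := fc_end F; have vf := st_valid (ec_stuck E).
have [[ab ac ad] [ba bc bd] [ca cb cd] [da db dc]] := fc_neqs F.
have [[aO bO] [cO dO]] := ((ec_aO E, ec_bO E), (ec_cO E, fc_dO F)).
have qK : q \notin kcomp f c d w by rewrite (kcomp_sym vf).
have hK := kcomp_notin vf (fc_link_cd F) nw.
split=> //; split; rewrite ?(miss_out _ _ _ _ hK) ?(flip_keep _ ac ad (fc_h F)) ?(fc_d F) //.
apply: (end_flip E) => //; first exact: kcomp_closed.
- by rewrite miss_other // (ec_b E).
- by rewrite miss_out // (ec_c E).
- by apply: flip_keep => //; apply: ec_a E.
Qed.

Lemma end_qb_c f p q r a b c y : end_conf f p q r a b c -> f q y = b -> ~~ miss f y c.
Proof.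
move=> E qy; apply/negP => my; have vf := st_valid (ec_stuck E).
have := kcomp_sub (kclosed2 vf (palette_ord (ec_bO E)) qy (ec_c E) my).
move/(_ q r); rewrite (kcomp_sym vf) => /(_ _ (ec_link_bc E)).
rewrite !inE eqxx => /(_ isT); rewrite (negPf (ec_nrq E)) /= => /eqP ry.
by move: zO; rewrite -(ec_qr E) ry qy (ec_bO E).
Qed.

(** Such a [y] would end the a/b-path of [r], so [core_b] applies. A [d] missing at [s] is turned
    into [c] first, because a b/d-switch might recolour [qy]. *)
Lemma end_qb_a f p q r h a b c d y : full_conf f p q r h a b c d ->
  f q y = b -> ~~ miss f y a.
Proof.
move=> F qy; apply/negP => my; have E := fc_end F.
have [s hs] := fc_s F; have vf := st_valid (ec_stuck E).
have [[ab ac ad] [ba bc bd] [ca cb cd] [da db dc]] := fc_neqs F.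
have [[aO bO] [cO dO]] := ((ec_aO E, ec_bO E), (ec_cO E, fc_dO F)).
have [bz cz dz] : [/\ z != b, z != c & z != d] by rewrite !(eq_sym z) !ord_neqz.
have case_b g : full_conf g p q r h a b c d -> g q y = b -> miss g y a -> g h s = z ->
    ~~ miss g s b.
  move=> G gqy gy ghs; have EG := fc_end G.
  have yr : y \in kcomp g a b r.
    by apply: kcomp_edge (ec_link_ab EG); rewrite gqy !inE eqxx orbT.
  apply: core_b G yr _ gy ghs; apply: contraNneq zO => e.
  by rewrite -(ec_qr EG) -e gqy.
have case_c g : full_conf g p q r h a b c d -> g q y = b -> miss g y a -> g h s = z ->
    ~~ miss g s c.
  move=> G gqy gy ghs; apply/negP => ms; have EG := fc_end G.
  have vg := st_valid (ec_stuck EG).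
  have ns : s \notin kcomp g b c r.
    apply: (three_ends vg (ord_neq0 bO) (ord_neq0 cO) _ _ _ (ec_link_bc EG));
    by rewrite ?(ec_b EG) ?(ec_c EG) ?ms ?orbT ?(ec_nrq EG) ?(fc_nsr G ghs) ?(fc_nsq G ghs).
  have [G' [qK rK]] := fc_flip_bc G ns.
  have := case_b _ G'; rewrite flip_out // miss_other // => /(_ gqy gy (flip_keep _ bz cz ghs)).
  by rewrite miss_in ?kcomp_refl // swapL ms.
have [e] := fc_ordinary F hs; rewrite !inE => /or4P[] /eqP-> ms.
- by have := core_a F hs; rewrite ms.
- by have := case_b f F qy my hs; rewrite ms.
- by have := case_c f F qy my hs; rewrite ms.
have ns : s \notin kcomp f c d q.
  apply: (three_ends vf (ord_neq0 cO) (ord_neq0 dO) _ _ _ (fc_link_cd F));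
  by rewrite ?(ec_c E) ?(fc_d F) ?ms ?orbT // ?(fc_nsq F hs) // eq_sym
     ?(eh_nhq E (fc_h F)) ?(z_neq vf hs).
have [F' qK] := fc_flip_cd F ns.
have := case_c _ F'; rewrite flip_out // miss_other // => /(_ qy my (flip_keep _ cz dz hs)).
by rewrite miss_in ?kcomp_refl // swapL ms.
Qed.

(** The [b]-neighbour [y] of [q] can miss no ordinary colour but [d]. As the c/d-path of [q] ends at
    [h], any other [y] could be switched to miss [c], against [end_qb_c]. *)
Lemma fc_qb f p q r h a b c d : full_conf f p q r h a b c d -> f q h = b.
Proof.
move=> F; have E := fc_end F; have sf := ec_stuck E; have vf := st_valid sf.
have [[ab ac ad] [ba bc bd] [ca cb cd] [da db dc]] := fc_neqs F.
have [[aO bO] [cO dO]] := ((ec_aO E, ec_bO E), (ec_cO E, fc_dO F)).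
have [y qy] := missPn (ec_q_b E).
have yz : ~~ miss f y z.
  apply/negP => my.
  (* Moving [z] from [qr] to [qy] makes [p q y] an end configuration, so [y] would be the
     [c]-neighbour of [p], which is [r]. *)
  have sg := shift sf (ec_qr E) (ec_bad_qr E) bO (ec_b E) qy my.
  set g := flip _ _ _ _ in sg.
  have npy : p != y by apply: contraNneq ab => e; rewrite -(ec_qp E) e qy.
  have pout : p \notin [set x in [:: r; q; y]].
    by rewrite !inE !negb_or (ec_npr E) (ec_npq E) npy.
  have EG : end_conf g p q y a b c.
    split=> //.
    - by rewrite miss_out ?(ec_p E).
    - exact: ec_pq E.
    - by rewrite /g flip_in ?qy ?swapR // !inE eqxx orbT.
    - by rewrite /g flip_out ?(ec_a E).
    - by rewrite miss_in ?swapR // !inE eqxx !orbT.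
    - by rewrite miss_other ?(ec_c E) // ord_neqz.
  have := end_rp EG; rewrite (vsym (st_valid sg)) /g flip_out // => py.
  have yr : y = r.
    by apply: (vinj vf (x := p)); rewrite py ?ord_neq0 // (vsym vf) (end_rp E).
  by move: zO; rewrite -(ec_qr E) -yr qy bO.
have [e eO my] := stuck_ordinary sf yz.
have := fc_cover F eO; rewrite !inE => /or4P[] /eqP eE; rewrite eE in my.
- by have := end_qb_a F qy; rewrite my.
- by have := miss_neq q my; rewrite (vsym vf) qy eqxx.
- by have := end_qb_c E qy; rewrite my.
have [<- //|nyh] := eqVneq y h.
have ny : y \notin kcomp f c d q.
  apply: (three_ends vf (ord_neq0 cO) (ord_neq0 dO) _ _ _ (fc_link_cd F));
  rewrite ?(ec_c E) ?(fc_d F) ?my ?orbT // ?nyh // 1?eq_sym ?(eh_nhq E (fc_h F)) //.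
  by apply: contraNneq O0 => e0; rewrite -(virr vf q) {2}e0 qy.
have [F' qK] := fc_flip_cd F ny.
have := end_qb_c (fc_end F') (y := y).
by rewrite flip_out // miss_in ?kcomp_refl // swapL my => /(_ qy).
Qed.

(* Shifting [z] from [qr] to [pr] exchanges the roles of [p] and [q], so that [h] is the
   [b]-neighbour of both. *)
Lemma no_end f p q r a b c : ~ end_conf f p q r a b c.
Proof.
move=> E; have [h [d F]] := end_full E; have sf := ec_stuck E; have vf := st_valid sf.
have [[ab ac ad] [ba bc bd] [ca cb cd] [da db dc]] := fc_neqs F.
have [[aO bO] [cO dO]] := ((ec_aO E, ec_bO E), (ec_cO E, fc_dO F)).
have [az bz cz dz] : [/\ a != z, b != z, c != z & d != z] by rewrite !ord_neqz.
have sg := shift sf (ec_rq E) (ec_bad_rq E) cO (ec_c E) (end_rp E) (ec_p E).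
set g := flip _ _ _ _ in sg.
have EG : end_conf g q p r a b c.
  split=> //.
  - by rewrite miss_in ?swapL ?(ec_c E) // !inE eqxx.
  - exact: ec_mq E.
  - by rewrite /g flip_in ?(vsym vf p) ?(end_rp E) ?swapR // !inE eqxx !orbT.
  - by apply: flip_keep (ec_qp E).
  - by rewrite miss_other ?(ec_b E).
  - by rewrite miss_in ?swapR ?(ec_p E) // !inE eqxx !orbT.
have G : full_conf g q p r h a b c d.
  split=> //; first exact: flip_keep (fc_h F).
  by rewrite miss_other ?(fc_d F).
have /eqP := fc_qb G; rewrite flip_other // => /eqP ph.
have := ec_npq E; rewrite (vinj vf (x := h) (y := p) (y' := q)) ?eqxx //.
  by rewrite !(vsym vf h) ph (fc_qb F).
by rewrite (vsym vf) ph ord_neq0.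
Qed.

(** A vertex without [z] would give an end configuration through the z-edge of its partner. With no
    such vertex, every vertex misses an ordinary colour and a fan removes any wrong edge. *)
Lemma stuck_matching f x y : stuck f -> (f x y == z) = (y == mt x).
Proof.
move=> sf; have vf := st_valid sf.
suff no_bad u v : f u v = z -> v = mt u.
  apply/eqP/eqP => [/no_bad //|->].
  have has_z u : ~~ miss f u z -> f u (mt u) = z.
    by case/missPn => v fuv; rewrite -(no_bad _ _ fuv).
  have [m|/has_z //] := boolP (miss f x z).
  by have := has_z _ (not_both_free sf m); rewrite mtK (vsym vf).
move=> fuv; apply/eqP; apply: contraT => vu.
have [|a aO ma] := @stuck_ordinary f u sf; first by apply/negP => /missP/(_ v).
have no_free w : ~~ miss f w z.
  apply/negP => mw; have mq := not_both_free sf mw.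
  have [r qr] := missPn mq.
  have [c cO mc] := stuck_ordinary sf mq.
  have [|b bO mb] := @stuck_ordinary f r sf.
    by apply/negP => /missP/(_ (mt w)); rewrite (vsym vf).
  by apply: (@no_end f w (mt w) r _ b c); split.
have [w _|g rg dg] := vizing_fan vf fuv aO ma.
  exact: stuck_ordinary sf (no_free w).
by case: (no_drop sf fuv vu rg dg).
Qed.

Lemma reach_matching f : valid C f -> (forall x, #|nbrs f x| <= size O) ->
  (forall x, f x (mt x) != 0) ->
  exists2 g, reach C f g & forall x y, (g x y == z) = (y == mt x).
Proof.
move: {2}(mu f).+1 (ltnSn (mu f)) => n; elim: n f => // n IH f le vf df mf.
have [[g [rg lt]]|no] := classic (exists g, reach C f g /\ mu g < mu f).
  have [||x|x|g' rg' gz] := IH g; first exact: leq_trans lt _.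
  - exact: reach_valid rg vf.
  - suff -> : nbrs g x = nbrs f x by [].
    by apply/setP => y; rewrite !inE (reach_0 palette0 rg).
  - by rewrite (reach_0 palette0 rg).
  by exists g' => //; apply: reach_trans rg rg'.
exists f; first exact: reach_refl.
move=> x y; apply: stuck_matching; split=> // g rg.
by rewrite leqNgt; apply/negP => lt; apply: no; exists g.
Qed.

End Matching.

End Palette.

(** * Peeling off colour classes *)

Section Classes.
Variables (T : finType) (z : nat) (O : seq nat).
Hypotheses (z0 : z != 0) (O0 : 0 \notin O) (zO : z \notin O).
Hypotheses (uniqO : uniq O).
Implicit Types f g : T -> T -> nat.

(** * Doubling the graph *)

Section Double.
Variables (f g : T -> T -> nat) (C : seq nat).
Hypotheses (vf : valid (z :: O) f) (vg : valid C g).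
Hypothesis same0 : forall x y, (g x y == 0) = (f x y == 0).
Hypothesis deg : forall x, #|nbrs f x| <= size O.
Hypothesis deg_free : forall x, miss g x z -> #|nbrs f x| < size O.
Hypothesis sizeO : size O <= 4.

(** Both copies of [x] see the same colours, so one choice suits both ends of the joining edge. By
    [free_colP] the default [0] does not arise where copies are joined. *)
Definition free_col x := head 0 [seq a <- z :: O | miss f x a].

(* Two copies of the graph; joining the two copies of each vertex that the z-class of
   [g] does not cover makes this class a perfect matching. *)
Definition double (x y : T * bool) :=
  if x.2 == y.2 then f x.1 y.1
  else if (x.1 == y.1) && miss g x.1 z then free_col x.1 else 0.

Definition double_mate (x : T * bool) :=
  if [pick y | g x.1 y == z] is Some y then (y, x.2) else (x.1, ~~ x.2).

Lemma free_colP x : miss g x z -> free_col x \in z :: O /\ miss f x (free_col x).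
Proof.
move=> gx; rewrite /free_col.
case: [seq _ <- _ | _] (mem_filter (miss f x) ^~ (z :: O)) => [|a s] memE.
  have [a aO ma] := exists_missing uniqO O0 (deg_free gx).
  by have := memE a; rewrite ma inE aO orbT.
by have := memE a; rewrite mem_head => /esym/andP[].
Qed.

Let palette0 := palette0 z0 O0.

Lemma mateP x y : g x.1 y = z -> double_mate x = (y, x.2).
Proof.
move=> gz; rewrite /double_mate; case: pickP => [y' /eqP gz'|/(_ y)]; last by rewrite gz eqxx.
by rewrite (vinj vg (x := x.1) (y := y') (y' := y)) ?gz' ?gz.
Qed.

Lemma mate_free x : miss g x.1 z -> double_mate x = (x.1, ~~ x.2).
Proof. by move=> /missP m; rewrite /double_mate; case: pickP => // y /eqP /m. Qed.

Lemma double_mateK : involutive double_mate.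
Proof.
move=> x; have [m|/missPn[y gz]] := boolP (miss g x.1 z).
  by rewrite (mate_free m) mate_free //= negbK -surjective_pairing.
rewrite (mateP gz) (@mateP _ x.1) //= ?(vsym vg y) //.
by rewrite -surjective_pairing.
Qed.

Lemma double_mate_neq x : double_mate x != x.
Proof.
case: x => x i; have [m|/missPn[y gz]] := boolP (miss g x z).
  by rewrite mate_free // xpair_eqE; case: i; rewrite andbF.
rewrite (@mateP _ y) // xpair_eqE eqxx andbT.
by apply: contraNneq z0 => e; rewrite -gz e (virr vg).
Qed.

Lemma valid_double : valid (z :: O) double.
Proof.
split=> [[x i] [y j]|[x i]|[x i] [y j]|[x i] [y j] [y' j']]; rewrite /double /=.
- rewrite [j == i]eq_sym; case: eqP => // _; first exact: vsym vf _ _.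
  by rewrite [y == x]eq_sym; case: eqP => //= ->.
- by rewrite eqxx (virr vf).
- case: (i =P j) => // _; first exact: (vcol vf).
  by case: ifP => // /andP[_ /free_colP[]].
case: (i =P j) => [<-|ij]; case: (i =P j') => [<-|ij'].
- by move=> e fy; rewrite (vinj vf e fy).
- case: ifP => [/andP[_ /free_colP[_ m]] e|_ ->]; last by rewrite eqxx.
  by have := miss_neq y m; rewrite e eqxx.
- case: ifP => // /andP[_ /free_colP[_ m]] e.
  by have := miss_neq y' m; rewrite -e eqxx.
case: ifP => // /andP[/eqP-> _]; case: ifP => [/andP[/eqP-> _] _ _|_ ->]; last by rewrite eqxx.
by case: i j j' ij ij' => [] [] [].
Qed.

(** A joining edge adds one to the degree, for which [deg_free] leaves room. *)
Lemma double_deg x : #|nbrs double x| <= size O.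
Proof.
case: x => x i; have emb : #|[set (y, i) | y in nbrs f x]| <= #|nbrs f x| by apply: leq_imset_card.
have [m|m] := boolP (miss g x z).
  apply: leq_trans (leq_ltn_trans emb (deg_free m)).
  apply: leq_trans (_ : #|(x, ~~ i) |: [set (y, i) | y in nbrs f x]| <= _).
    apply/subset_leq_card/subsetP => -[y j]; rewrite !inE /double /= xpair_eqE.
    case: (i =P j) => [<- fy|ij]; first by rewrite mem_imset ?inE ?fy ?orbT // => ? ? [].
    case: ifP => [/andP[/eqP-> _] _|//]; apply/orP; left; rewrite eqxx /=.
    by apply/eqP; move: ij; clear; case: i j => [] [].
  by rewrite cardsU1; case: (_ \notin _).
apply: leq_trans (leq_trans emb (deg x)).
apply/subset_leq_card/subsetP => -[y j]; rewrite !inE /double /= (negPf m) andbF.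
case: (i =P j) => [<- fy|//]; by rewrite mem_imset ?inE // => ? ? [].
Qed.

Lemma double_mate_edge x : double x (double_mate x) != 0.
Proof.
have [m|/missPn[y gz]] := boolP (miss g x.1 z).
  rewrite (mate_free m) /double /= eqxx m; have [c _] := free_colP m.
  by case: x.2; apply: contraNneq palette0 => <-.
by rewrite (mateP gz) /double /= eqxx -same0 gz.
Qed.

(** All switches in the doubled graph are restricted to one copy. The mate of a vertex covered by
    the z-class of [g] lies in the same copy. *)
Lemma reach_class : exists2 f', reach (z :: O) f f' &
  forall x y, (f' x y == z) = (g x y == z).
Proof.
have [G rG zG] := reach_matching z0 O0 zO uniqO sizeO double_mateK double_mate_neq
  valid_double double_deg double_mate_edge.
exists (fun x y => G (x, false) (y, false)).
  by apply: reach_eql (reach_embed (fun x => (x, false)) rG) => x y; rewrite /double.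
move=> x y; rewrite zG.
have [m|/missPn[y' gz]] := boolP (miss g x z).
  by rewrite mate_free // xpair_eqE andbF (negPf (miss_neq _ m)).
rewrite (@mateP _ y') // xpair_eqE andbT; apply/eqP/eqP => [-> //|gy].
by apply: (vinj vg (x := x)); rewrite gy ?gz.
Qed.

End Double.

(** Every vertex always misses an ordinary colour, so fans remove the z-edges one by one. *)
Lemma reach_drop_color f : valid (z :: O) f -> (forall x, #|nbrs f x| < size O) ->
  exists2 f', reach (z :: O) f f' & valid O f'.
Proof.
pose n f := #|[set p : T * T | f p.1 p.2 == z]|.
move: {2}(n f).+1 (ltnSn (n f)) => k; elim: k f => // k IH f le vf deg.
have [/existsP[u /existsP[v /eqP fuv]]|no] := boolP [exists u, exists v, f u v == z].
  have ordinary x : exists2 b, b \in O & miss f x b.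
    exact: exists_missing uniqO O0 (deg x).
  have [a aO ma] := ordinary u.
  have [w _|g rg dg] := vizing_fan z0 O0 zO vf fuv aO ma; first exact: ordinary.
  have [||x|h rh vh] := IH g.
  - apply: (@leq_trans (n f)) le; apply: proper_card; apply/properP; split.
      by apply/subsetP => -[x y]; rewrite !inE dg => /andP[].
    by exists (u, v); rewrite !inE ?fuv ?dg /= ?fuv ?eqxx.
  - exact: reach_valid (palette0 z0 O0) rg vf.
  - suff -> : nbrs g x = nbrs f x by [].
    by apply/setP => y; rewrite !inE (reach_0 (palette0 z0 O0) rg).
  by exists h => //; apply: reach_trans rg rh.
exists f; first exact: reach_refl.
split; [exact: vsym vf|exact: virr vf| |exact: vinj vf].
move=> x y /(vcol vf); rewrite inE => /predU1P[e|//].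
by case/existsP: no; exists x; apply/existsP; exists y; rewrite e.
Qed.

(** Switches of colours other than [z] ignore z-edges, so a deleted z-class can be put back. *)
Lemma reach_patch (N : T -> T -> bool) f g : reach O f g ->
  reach (z :: O) (fun x y => if N x y then z else f x y)
                 (fun x y => if N x y then z else g x y).
Proof.
elim=> {f g} [f g fg|f g a b K aO bO cl _ IH].
  by apply: reach_eq => x y; rewrite fg.
have [za zb] : z != a /\ z != b by rewrite !(eq_sym z) !(ord_neqz zO).
apply: (@reach_flip _ _ _ _ a b K); rewrite ?palette_ord //.
  move=> x y xK; case: ifP => _; last exact: cl.
  by rewrite !inE (negPf za) (negPf zb).
by apply: reach_eql IH => x y; rewrite /flip; do 2?case: ifP => //; rewrite swap_id.
Qed.

End Classes.

(** Induction on the palette. The spare colour [e], absent from [g], is never the colour [z] that is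
    peeled off; once only [e] is left there are no edges. *)
Lemma reach_target (T : finType) (C : seq nat) e (f g : T -> T -> nat) :
  uniq C -> 0 \notin C -> size C <= 5 -> e \in C -> valid C f -> valid C g ->
  (forall x y, g x y != e) -> (forall x y, (g x y == 0) = (f x y == 0)) ->
  reach C f g.
Proof.
move: {2}(size C) (erefl (size C)) => n.
elim: n C f g => [|n IH] C f g sz U C0 s5 eC vf vg ge fg0.
  by case: C sz eC {U C0 s5 vf vg}.
have [/hasP[z zC ze]|/hasPn only_e] := boolP (has (fun z => z != e) C); last first.
  apply: reach_eq => x y; have g0 : g x y = 0.
    apply/eqP; apply: contraT => /(vcol vg)/only_e; by rewrite (negPf (ge x y)).
  by rewrite g0; apply/eqP; rewrite -fg0 g0.
have perm := perm_to_rem zC; set O := rem z C in perm.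
have /= /andP[zO UO] : uniq (z :: O) by rewrite -(perm_uniq perm).
have := C0; rewrite (perm_mem perm) inE negb_or eq_sym => /andP[z0 O0].
have CO : {subset C <= z :: O} by move=> x; rewrite (perm_mem perm).
have OC : {subset z :: O <= C} by move=> x; rewrite (perm_mem perm).
have szO : size O = n by have := perm_size perm; rewrite sz /= => -[].
have eO : e \in O by have := CO _ eC; rewrite inE eq_sym (negPf ze).
have nbrsE x : nbrs f x = nbrs g x by apply/setP => y; rewrite !inE fg0.
have size_e : size (rem e C) = n by rewrite size_rem // sz.
have mem_e x y : g x y != 0 -> g x y \in rem e C.
  by move=> /(vcol vg) gC; rewrite (rem_filter _ U) mem_filter /= ge.
(* At each vertex [g] avoids [e], which bounds the degree by [size O]; where it also misses [z], the
   bound is one less. *)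
have [x|x m||f1 rf1 f1z] := reach_class z0 O0 zO UO (valid_sub CO vf) vg fg0.
- by rewrite nbrsE szO -size_e; apply: card_nbrs_le vg (mem_e x).
- have ze' : z \in rem e C by rewrite (rem_filter _ U) mem_filter /= ze.
  have n0 : 0 < n by rewrite -szO; case: (O) eO.
  apply: (@leq_ltn_trans (size (rem z (rem e C)))); last by rewrite size_rem // size_e szO prednK.
  rewrite nbrsE; apply: card_nbrs_le vg _ => y gy.
  by rewrite (rem_filter _ (rem_uniq e U)) mem_filter /= (miss_neq _ m) mem_e.
- by rewrite szO; move: s5; rewrite sz.
(* Entry [0] deletes the common z-class from both colourings. *)
pose f2 x y := if g x y == z then 0 else f1 x y.
pose g2 x y := if g x y == z then 0 else g x y.
have vf1 : valid (z :: O) f1 := reach_valid (palette0 z0 O0) rf1 (valid_sub CO vf).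
have f10 := reach_0 (palette0 z0 O0) rf1.
have valid2 k : valid (z :: O) k -> (forall x y, (k x y == z) = (g x y == z)) ->
    valid O (fun x y => if g x y == z then 0 else k x y).
  move=> vk kz; split=> [x y|x|x y|x y y'].
  - by rewrite (vsym vg) (vsym vk).
  - by rewrite (virr vk); case: ifP.
  - by case: ifP => // gz /(vcol vk); rewrite inE kz gz.
  - by case: ifP => // _; case: ifP => [_ ->|_]; [rewrite eqxx|apply: vinj vk _ _ _].
have r2 : reach O f2 g2.
  apply: IH => //.
  - by rewrite szO ltnW // -sz.
  - exact: valid2.
  - by apply: valid2 => //; apply: valid_sub vg.
  - move=> x y; rewrite /g2; case: ifP => // _.
    by apply: contraNneq O0 => ->.
  - by move=> x y; rewrite /f2 /g2; case: ifP => // _; rewrite f10 fg0.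
apply: reach_sub OC _; apply: reach_trans rf1 _.
have := reach_patch zO (fun x y => g x y == z) r2; rewrite /f2 /g2 => r.
have e1 : f1 =2 (fun x y => if g x y == z then z else f2 x y).
  by move=> x y; rewrite /f2; case: ifP => gz; [apply/eqP; rewrite f1z|rewrite gz].
apply: reach_eql e1 (reach_trans r (reach_eq _ _)) => x y.
by case: eqP => [->|].
Qed.

(** Removing the largest of more than five colours leaves at least five, which exceeds every
    degree. *)
Lemma reach_five (T : finType) t (f : T -> T -> nat) : 5 <= t ->
  valid (iota 1 t) f -> (forall x, #|nbrs f x| <= 4) ->
  exists2 f', reach (iota 1 t) f f' & valid (iota 1 5) f'.
Proof.
move=> t5; rewrite -(subnKC t5); elim: (t - 5) f => [|n IH] f vf deg.
  by exists f => //; apply: reach_refl.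
set z := (5 + n).+1; set O := iota 1 (5 + n).
have CE : iota 1 (5 + n.+1) =i z :: O.
  by move=> x; rewrite mem_iota in_cons mem_iota /z; lia.
have zO : z \notin O by rewrite mem_iota /z; lia.
have O0 : 0 \notin O by rewrite mem_iota.
have vf' : valid (z :: O) f by apply: valid_sub vf => x; rewrite CE.
have [|f1 r1 v1] := reach_drop_color (z := z) isT O0 zO (iota_uniq _ _) vf'.
  by move=> x; rewrite size_iota; apply: leq_ltn_trans (deg x) _.
have [x|f2 r2 v2] := IH f1 v1.
  have -> : nbrs f1 x = nbrs f x; last exact: deg.
  by apply/setP => y; rewrite !inE (reach_0 (palette0 (z := z) isT O0) r1).
exists f2 => //; apply: reach_trans (reach_sub _ r1) (reach_sub _ r2) => x; rewrite CE //.
by move=> xO; rewrite in_cons; apply/orP; right.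
Qed.

(** * From vertex pairs to edges *)

Section Edges.
Variables (T : finType) (e : rel T).
Implicit Types (f g : {ffun Edge e -> nat}) (E : Edge e).

Definition edge_at (x y : T) : option (Edge e) := insub [set x; y].

Definition color_at f (x y : T) := if edge_at x y is Some E then f E else 0.

Lemma edge_atC x y : edge_at x y = edge_at y x.
Proof. by rewrite /edge_at setUC. Qed.

Lemma edge_atP x y E : edge_at x y = Some E -> val E = [set x; y].
Proof. by rewrite /edge_at; case: insubP => // E' _ <- [->]. Qed.

Lemma edge_ends E : exists x y, edge_at x y = Some E.
Proof.
have := valP E; rewrite inE => /existsP[x /existsP[y /andP[_ /eqP v]]].
exists x, y; rewrite /edge_at; case: insubP => [E' _ vE'|].
  by congr Some; apply: val_inj; rewrite vE' v.
by rewrite -v (valP E).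
Qed.

Lemma color_at_inj f g : color_at f =2 color_at g -> f = g.
Proof.
move=> fg; apply/ffunP => E; have [x [y xy]] := edge_ends E.
by have := fg x y; rewrite /color_at xy.
Qed.

Lemma valid_color_at t f : irreflexive e -> proper_coloring t f ->
  valid (iota 1 t) (color_at f).
Proof.
move=> e_irr [rng prop]; split=> [x y|x|x y|x y y'].
- by rewrite /color_at edge_atC.
- rewrite /color_at; case exx: edge_at => [E|] //; have := valP E.
  rewrite (edge_atP exx) inE => /existsP[u /existsP[v /andP[uv /eqP eq]]].
  have : u \in [set x; x] by rewrite eq !inE eqxx.
  have : v \in [set x; x] by rewrite eq !inE eqxx orbT.
  by rewrite !inE !orbb => /eqP ev /eqP eu; rewrite eu ev e_irr in uv.
- by rewrite /color_at; case: edge_at => // E _; rewrite mem_iota add1n ltnS rng.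
rewrite /color_at; case exy: edge_at => [E|] //; case exy': edge_at => [E'|]; last by move=> ->.
move=> fE _; have [EE|nEE] := eqVneq E E'; last first.
  have /prop : adj_edges E E'.
    rewrite /adj_edges nEE; apply/set0Pn; exists x.
    by rewrite (edge_atP exy) (edge_atP exy') !inE eqxx.
  by rewrite fE eqxx.
have := edge_atP exy; rewrite EE (edge_atP exy') => sE.
have : y \in [set x; y'] by rewrite sE !inE eqxx orbT.
have : y' \in [set x; y] by rewrite -sE !inE eqxx orbT.
by rewrite !inE => /orP[] /eqP -> // /orP[] /eqP ->.
Qed.


Lemma kempe_trans t f g h : kempe_reach t f g -> kempe_reach t g h -> kempe_reach t f h.
Proof. by elim=> {f g} // f g g' fg _ IH /IH; apply: kr_step. Qed.

Lemma kempe_rel_sym f a b : symmetric (kempe_rel f a b).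
Proof.
move=> E E'; rewrite /kempe_rel /adj_edges [E' == E]eq_sym setIC.
by rewrite andbCA.
Qed.

(** The set [S] is a union of components, which are interchanged one at a time. *)
Lemma kempe_swap t a b f (S : {set Edge e}) : 1 <= a <= t -> 1 <= b <= t ->
  (forall E, E \in S -> f E \in [:: a; b]) ->
  (forall E E', E \in S -> kempe_rel f a b E E' -> E' \in S) ->
  kempe_reach t f [ffun E => if E \in S then swap a b (f E) else f E].
Proof.
move=> ha hb; move: {2}#|S|.+1 (ltnSn #|S|) => n; elim: n f S => // n IH f S le Sab Scl.
have [->|[E0 E0S]] := set_0Vmem S.
  set g := [ffun _ => _]; suff -> : g = f by apply: kr_refl.
  by apply/ffunP => E; rewrite ffunE inE.
pose R := connect (kempe_rel f a b) E0.
pose g := [ffun E => if R E then swap a b (f E) else f E].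
have swap_ab c : (swap a b c \in [:: a; b]) = (c \in [:: a; b]).
  by rewrite !inE !eq_swap swapL swapR orbC.
(* An interchange preserves the set of a/b-edges, hence the remaining components. *)
have gab E : (g E \in [:: a; b]) = (f E \in [:: a; b]).
  by rewrite ffunE; case: ifP.
have RS E : R E -> E \in S.
  case/connectP=> p; elim: p (E0) E0S => [|E1 p IHp] E2 E2S /=; first by move=> _ ->.
  by case/andP=> /(Scl _ _ E2S) E1S; apply: IHp.
have -> : [ffun E => if E \in S then swap a b (f E) else f E] =
    [ffun E => if E \in [set E in S | ~~ R E] then swap a b (g E) else g E].
  apply/ffunP => E; rewrite !ffunE inE; have [/RS-> //|nR] := boolP (R E).
  by rewrite andbT.
apply: (kr_step (g := g)).
  by exists a, b, E0; split=> // [|E]; [apply: Sab|rewrite ffunE].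
apply: IH.
- apply: (@leq_trans #|S|) le; apply: proper_card; apply/properP; split.
    by apply/subsetP => E; rewrite inE => /andP[].
  by exists E0; rewrite // inE /R connect0 andbF.
- by move=> E; rewrite inE gab => /andP[/Sab].
move=> E E'; rewrite !inE => /andP[ES nR] EE'.
have {}EE' : kempe_rel f a b E E' by move: EE'; rewrite /kempe_rel !gab.
rewrite (Scl _ _ ES EE'); apply: contra nR => RE'; apply: connect_trans RE' _.
by apply: connect1; rewrite kempe_rel_sym.
Qed.

Lemma reach_kempe t c d : reach (iota 1 t) c d -> forall f, c =2 color_at f ->
  exists2 g, kempe_reach t f g & d =2 color_at g.
Proof.
elim=> {c d} [c d cd f cf|c d a b K aC bC cl _ IH f cf].
  by exists f; [apply: kr_refl|move=> x y; rewrite -cd].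
have [ha hb] : 1 <= a <= t /\ 1 <= b <= t.
  by move: aC bC; rewrite !mem_iota add1n !ltnS.
(* Since [K] is closed, an a/b-edge that meets [K] lies inside it. *)
pose S := [set E | (f E \in [:: a; b]) && [exists x in K, x \in val E]].
pose g := [ffun E => if E \in S then swap a b (f E) else f E].
have [|h gh dh] := IH g; last first.
  exists h => //; apply: kempe_trans gh; apply: kempe_swap => //.
    by move=> E; rewrite inE => /andP[].
  move=> E E'; rewrite inE => /andP[fE /exists_inP[x xK xE]] /and3P[_ fE' /andP[_]].
  case/set0Pn => w; rewrite inE => /andP[wE wE']; rewrite inE fE'; apply/exists_inP; exists w => //.
  have [u [v uv]] := edge_ends E; rewrite (edge_atP uv) in xE wE.
  have cuv : c u v \in [:: a; b] by rewrite cf /color_at uv.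
  have cvu : c v u \in [:: a; b] by rewrite cf /color_at edge_atC uv.
  have Kuv : (u \in K) = (v \in K).
    by apply/idP/idP => [/cl /(_ cuv)|/cl /(_ cvu)].
  by case/set2P: xE wE xK => -> /set2P[] -> //; rewrite Kuv.
move=> x y; rewrite /flip cf /color_at; case xy: edge_at => [E|]; last first.
  by case: ifP => // _; rewrite swap_id // eq_sym -lt0n; [case/andP: ha|case/andP: hb].
have cxy : c x y = f E by rewrite cf /color_at xy.
have cyx : c y x = f E by rewrite cf /color_at edge_atC xy.
rewrite ffunE inE; have [fE|fE] /= := boolP (f E \in [:: a; b]); last first.
  by case: ifP => // _; rewrite swap_id //; apply: contraNneq fE => ->; rewrite !inE eqxx ?orbT.
suff -> : [exists x0 in K, x0 \in val E] = (x \in K) by [].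
apply/exists_inP/idP => [[w wK]|xK]; last by exists x; rewrite // (edge_atP xy) !inE eqxx.
rewrite (edge_atP xy) => /set2P[] wE; rewrite wE in wK => //.
by apply: cl wK _; rewrite cyx.
Qed.

End Edges.

Theorem theorem1p3 (T : finType) (e : rel T)
  (e_sym : symmetric e) (e_irr : irreflexive e) (t : nat) :
  class1 e -> maxdeg e = 4 -> 5 <= t ->
  forall f g : {ffun Edge e -> nat},
    proper_coloring t f -> proper_coloring 4 g ->
    kempe_reach t f g.
Proof.
move=> _ _ t5 f g pf pg.
have [vf vg] := (valid_color_at e_irr pf, valid_color_at e_irr pg).
have fg0 x y : (color_at g x y == 0) = (color_at f x y == 0).
  rewrite /color_at; case: edge_at => // E.
  by case: pf pg => [/(_ E)/andP[f0 _] _] [/(_ E)/andP[g0 _] _]; rewrite !eqn0Ngt f0 g0.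
(* The four colours of [g] bound every degree by 4. *)
have [x|f5 r5 v5] := reach_five t5 vf.
  have -> : nbrs (color_at f) x = nbrs (color_at g) x by apply/setP => y; rewrite !inE fg0.
  by rewrite -[4](size_iota 1 4); apply: card_nbrs_le vg (vcol vg (x := x)).
have sub5 : {subset iota 1 4 <= iota 1 5} by move=> c; rewrite !mem_iota; lia.
(* Colour 5, which [g] avoids, is the spare one. *)
have r := @reach_target T (iota 1 5) 5 f5 (color_at g) (iota_uniq _ _) isT isT isT v5
  (valid_sub sub5 vg).
have no5 x y : color_at g x y != 5.
  rewrite /color_at; case: edge_at => // E.
  by case: pg => /(_ E)/andP[_ g4] _; apply: contraTneq g4 => ->.
have f50 x y : (color_at g x y == 0) = (f5 x y == 0).
  by rewrite fg0 (reach_0 _ r5) // mem_iota.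
have sub_t : {subset iota 1 5 <= iota 1 t} by move=> c; rewrite !mem_iota; lia.
have r' := reach_trans r5 (reach_sub sub_t (r no5 f50)).
have [h fh gh] := reach_kempe r' (f := f) (fun _ _ => erefl).
by rewrite (color_at_inj gh).
Qed.
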